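(* Let $1<q<2<p<+\infty$ and $2<\theta\le 3$. Let $a_1\in L^{\frac{2}{2-q}}(\mathbb{R})\cap C(\mathbb{R})$ be a positive even function. Let $A:\mathbb{R}\to\mathbb{R}$ be Lipschitz, of class (at least) $C^1(\mathbb{R})$, non-decreasing, and such that there is $\gamma\in(0,1)$ with $0<\gamma\le A(t)$ for all $t\in\mathbb{R}$. Let $g:\mathbb{R}\to\mathbb{R}$ be continuous with $0\le s\,g(s)\le |s|^{\theta}$ for all $s\in\mathbb{R}$. Then there exists $\lambda^*>0$ such that for every $\lambda\in(0,\lambda^*]$ the problem $$\begin{cases}-(A(u)u')'(t)+u(t)=\lambda a_1(t)|u(t)|^{q-1}+|u(t)|^{p-1}+g(|u'(t)|), & t\in\mathbb{R},\\ u(t)>0, & t\in\mathbb{R},\\ \lim_{t\to\pm\infty}u(t)=0\end{cases}$$ has an even, positive solution $u_\lambda\in C^2(\mathbb{R})$ (homoclinic to the origin). Moreover, these solutions $u_\lambda$ satisfy $u_\lambda\to 0$ in $C^0(\mathbb{R})$ (i.e. $\sup_{t\in\mathbb{R}}|u_\lambda(t)|\to0$) as $\lambda\to0$.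
   Context: Here $(A(u)u')'(t)$ denotes the derivative of $t\mapsto A(u(t))u'(t)$. A solution $u\in C^2(\mathbb{R})$ satisfies the equation pointwise; homoclinic to the origin means $\lim_{t\to\pm\infty}u(t)=0$. *)

(* Defs.v *)
From HB Require Import structures.
From mathcomp Require Import all_boot all_order all_algebra.
From mathcomp Require Import all_classical all_reals all_analysis.
Set Implicit Arguments.
Unset Strict Implicit.
Unset Printing Implicit Defensive.
Import Order.TTheory GRing.Theory Num.Theory.
Import numFieldNormedType.Exports.
Local Open Scope classical_set_scope.
Local Open Scope ring_scope.

(* [derive1n] is total, so the existence of the derivatives is required
   separately; [derivable h t 1] is one-dimensional differentiability at t.
   Continuity of the derivatives of order below k follows. *)
Definition class_C (R : realType) (k : nat) (f : R -> R) : Prop :=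
  (forall i : nat, (i < k)%N -> forall t : R, derivable f^`(i)%classic t 1) /\
  continuous f^`(k)%classic.

Definition even_function (R : realType) (f : R -> R) : Prop :=
  forall t : R, f (- t) = f t.

(* The sup over the line is taken in \bar R: [sup] in R would return 0 on an
   unbounded set. *)
Definition sup_norm (R : realType) (f : R -> R) : \bar R :=
  ereal_sup (range (fun t : R => `|f t|%:E)).

(* The derivative of s |-> A (u s) * u' s is the total [derive1]; it is a genuine
   derivative as soon as A is of class C^1 and u of class C^2. *)
Definition solves_problem (R : realType) (q p : R) (A a1 g : R -> R)
    (lambda : R) (u : R -> R) : Prop :=
  [/\ forall t : R,
        - ((fun s : R => A (u s) * u^`()%classic s)%R^`()%classic t) + u t =
        lambda * a1 t * `|u t| `^ (q - 1) + `|u t| `^ (p - 1) +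
          g `|u^`()%classic t|,
      forall t : R, 0 < u t,
      u t @[t --> -oo] --> 0 &
      u t @[t --> +oo] --> 0].

(* Main.v *)
Require Import Defs.
From HB Require Import structures.
From mathcomp Require Import all_boot all_order all_algebra.
From mathcomp Require Import all_classical all_reals all_analysis.
From mathcomp Require Import ring lra.
Set Implicit Arguments.
Unset Strict Implicit.
Unset Printing Implicit Defensive.
Import Order.TTheory GRing.Theory Num.Theory.
Import numFieldNormedType.Exports.
Local Open Scope classical_set_scope.
Local Open Scope ring_scope.

(** The equation is the first order system [u' = w / A u], [w' = u - f] with
    [w = A(u) u'] and [f] the right-hand side.  An even solution has
    [w 0 = 0], so one looks for solutions of the boundary value problem
    [w 0 = 0], [u T = 0] and lets [T] go to infinity.

    The nonlinearity is first truncated at a level [eps] depending on the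
    lower bound of [A] and the exponents only, and raised by a small constant [eta].  The
    truncated problem on [0, T] is solved by shooting for an explicit Euler
    scheme ([bvp_exists]): the scheme depends continuously on the initial
    value, so the intermediate value theorem applies, and although [f] is not
    Lipschitz the step is sent to 0 by a compactness argument
    ([ode_compactness]).

    Three estimates are uniform in [T] and in small [eta].  A negative minimum is
    impossible ([solution_ge0]).  Testing the equation with [u] and absorbing
    the superlinear terms, which are small at the level [eps], bounds [u ^+ 2]
    and [w ^+ 2] by a multiple of [lam `^ (2 / (2 - q))] ([bvp_bound]); this is
    where the integrability of [a1] enters, through Young's inequality
    ([young_sublinear]).  Finally [u 0] is bounded below ([initial_value_lb]):
    a solution starting too low is dragged below 0 before time 1 by the concave
    term [lam * a1 * u `^ (q - 1)].  As [u = 0] solves the problem with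
    [eta = 0], it is this last bound that makes the limit nontrivial.

    Letting [T] go to infinity and [eta] to 0 gives a nonnegative even solution
    on the line ([entire_solution]).  It is positive because the concave term
    also excludes a first zero ([solution_gt0]), and it tends to 0 because the
    energy is bounded and monotone ([solution_decay]).  For small [lam] the
    bounds on [u] and [w] lie below the truncation levels, so the original
    equation holds, and the same bounds show that [u] tends to 0 uniformly
    with [lam]. *)

(** * One-variable calculus *)

Lemma is_derive1P (R : realType) (f : R -> R) (x d : R) :
  is_derive x 1 f d <->
  forall e : R, 0 < e -> exists2 del, 0 < del &
    forall y, `|y - x| < del -> `|f y - f x - d * (y - x)| <= e * `|y - x|.
Proof.
have E : (fun h : R => h^-1 *: ((f \o shift x) (h *: (1 : R)) - f x)) =
         (fun h : R => h^-1 *: (f (h + x) - f x)).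
  by apply/funext => h; rewrite /= /GRing.scale /= mulr1.
split=> [[dfx fxd] e e0|H].
  have : h^-1 *: (f (h + x) - f x) @[h --> 0^'] --> d.
    by rewrite -fxd -derive1E; move: dfx; rewrite /derivable E.
  move/cvgrPdist_le => /(_ e e0); move=> -[del /= del0 Hd].
  exists del => // y yx; have [->|yNx] := eqVneq y x.
    by rewrite !subrr mulr0 subr0 !normr0 mulr0.
  have yx0 : y - x != 0 by rewrite subr_eq0.
  have := Hd (y - x); rewrite /ball_ /= sub0r normrN => /(_ yx yx0).
  rewrite subrK => Hq.
  have -> : f y - f x - d * (y - x) =
            - (d - (y - x)^-1 *: (f y - f x)) * (y - x).
    rewrite /GRing.scale /= mulNr mulrBl [(y - x)^-1 * _]mulrC mulfVK //; ring.
  by rewrite normrM normrN ler_pM2r // normr_gt0.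
have cvgd : h^-1 *: (f (h + x) - f x) @[h --> 0^'] --> d.
  apply/cvgrPdist_le => e e0; have [del del0 Hd] := H e e0.
  exists del => //= h; rewrite /ball_ /= sub0r normrN => hd h0.
  have := Hd (h + x); rewrite addrK => /(_ hd).
  have -> : d - h^-1 *: (f (h + x) - f x) = - ((f (h + x) - f x - d * h) / h).
    by rewrite /GRing.scale /= mulrBl mulfK // opprB [_^-1 * _]mulrC.
  by rewrite normrN normrM normfV ler_pdivrMr ?normr_gt0.
have dfx : derivable f x 1 by rewrite /derivable E; apply/cvg_ex; exists d.
by apply: DeriveDef => //; rewrite -derive1E; apply/cvg_lim.
Qed.

Lemma is_derive_continuous (R : realType) (f : R -> R) (x d : R) :
  is_derive x 1 f d -> {for x, continuous f}.
Proof.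
by case=> + _; move/derivable1_diffP => /differentiable_continuous.
Qed.

Lemma is_derive_MVT (R : realType) (f f' : R -> R) (a b : R) : a <= b ->
  (forall x, a <= x <= b -> is_derive x 1 f (f' x)) ->
  exists2 c, a <= c <= b & f b - f a = f' c * (b - a).
Proof.
move=> ab H; have [||c] := @MVT_segment R f f' a b ab.
- by move=> x; rewrite in_itv /= => /andP[ax xb]; apply: H; rewrite !ltW.
- apply/continuous_in_subspaceT => x; rewrite inE /= in_itv /= => xab.
  exact: is_derive_continuous (H x xab).
- by rewrite in_itv /= => cab E; exists c.
Qed.

Lemma is_derive_ge0 (R : realType) (f f' : R -> R) (a b : R) : a <= b ->
  (forall x, a <= x <= b -> is_derive x 1 f (f' x)) ->
  (forall x, a <= x <= b -> 0 <= f' x) -> f a <= f b.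
Proof.
move=> ab H1 H2; have [c cab E] := is_derive_MVT ab H1.
by rewrite -subr_ge0 E mulr_ge0 ?H2 // subr_ge0.
Qed.

Lemma is_derive_le (R : realType) (f g f' g' : R -> R) (a b : R) : a <= b ->
  (forall x, a <= x <= b -> is_derive x 1 f (f' x)) ->
  (forall x, a <= x <= b -> is_derive x 1 g (g' x)) ->
  (forall x, a <= x <= b -> f' x <= g' x) -> f b - f a <= g b - g a.
Proof.
move=> ab Hf Hg H.
suff : (g - f) a <= (g - f) b by rewrite !fctE; lra.
apply: (@is_derive_ge0 R (g - f) (fun x => g' x - f' x) a b) => // x xab.
  by apply: is_deriveB; [exact: Hg|exact: Hf].
by rewrite subr_ge0 H.
Qed.

Lemma is_derive_lt0_right (R : realType) (f : R -> R) (x d : R) :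
  is_derive x 1 f d -> d < 0 ->
  exists2 del, 0 < del & forall y, x < y -> y < x + del -> f y < f x.
Proof.
move=> /is_derive1P H d0.
have [|del del0 Hd] := H (- d / 2); first by rewrite divr_gt0 ?oppr_gt0.
exists del => // y xy yd.
have := Hd y; rewrite ger0_norm; last by rewrite subr_ge0 ltW.
rewrite ltrBlDl => /(_ yd) /ler_normlP[_].
have : 0 < y - x by rewrite subr_gt0.
by move: (y - x) => z z0; nra.
Qed.

Lemma is_derive_norm_le (R : realType) (f g f' g' : R -> R) (a b : R) : a <= b ->
  (forall x, a <= x <= b -> is_derive x 1 f (f' x)) ->
  (forall x, a <= x <= b -> is_derive x 1 g (g' x)) ->
  (forall x, a <= x <= b -> `|f' x| <= g' x) -> `|f b - f a| <= g b - g a.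
Proof.
move=> ab Hf Hg H; apply/ler_normlP; split.
  rewrite opprB -[leLHS]opprK opprB.
  have := @is_derive_le R (- f) g (fun x => - f' x) g' a b ab _ Hg _.
  rewrite !fctE opprK [- f b + _]addrC opprB; apply.
    by move=> x /Hf; exact: is_deriveN.
  by move=> x /H /ler_normlP[].
by apply: (@is_derive_le R f g f' g') => // x /H /ler_normlP[].
Qed.

Lemma is_derive_add (R : realType) (f g : R -> R) (x df dg : R) :
  is_derive x 1 f df -> is_derive x 1 g dg ->
  is_derive x 1 (fun t => f t + g t) (df + dg).
Proof. by move=> ? ?; exact: is_deriveD. Qed.

Lemma is_derive_mul (R : realType) (f g : R -> R) (x df dg : R) :
  is_derive x 1 f df -> is_derive x 1 g dg ->
  is_derive x 1 (fun t => f t * g t) (df * g x + f x * dg).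
Proof.
move=> Hf Hg; have := is_deriveM Hf Hg.
by rewrite /GRing.scale /= addrC [g x * df]mulrC.
Qed.

Lemma is_derive_scale (R : realType) (f : R -> R) (k x df : R) :
  is_derive x 1 f df -> is_derive x 1 (fun t => k * f t) (k * df).
Proof. by move=> Hf; exact: is_deriveZ. Qed.

Lemma is_derive_le_linear (R : realType) (f f' : R -> R) (a b c : R) : a <= b ->
  (forall x, a <= x <= b -> is_derive x 1 f (f' x)) ->
  (forall x, a <= x <= b -> f' x <= c) -> f b - f a <= c * (b - a).
Proof.
move=> ab H1 H2; have [x xab ->] := is_derive_MVT ab H1.
by rewrite ler_wpM2r ?subr_ge0 // H2.
Qed.

Lemma is_derive_lt0_decr (R : realType) (f f' : R -> R) (a b : R) : a < b ->
  (forall x, a <= x <= b -> is_derive x 1 f (f' x)) ->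
  (forall x, a < x < b -> f' x < 0) -> f b < f a.
Proof.
move=> ab H1 H2; have [||c] := @MVT R f f' a b ab.
- by move=> x; rewrite in_itv /= => /andP[ax xb]; apply: H1; rewrite !ltW.
- apply/continuous_in_subspaceT => x; rewrite inE /= in_itv /= => xab.
  exact: is_derive_continuous (H1 x xab).
- rewrite in_itv /= => cab E; rewrite -subr_lt0 E nmulr_rlt0 ?subr_gt0 //.
  exact: H2.
Qed.

Lemma is_derive_min (R : realType) (f f' : R -> R) (a b t : R) :
  (forall x : R, is_derive x 1 f (f' x)) -> a < t < b ->
  (forall s, a < s < b -> f t <= f s) -> f' t = 0.
Proof.
move=> df tab H; have /andP[ta tb] := tab.
have d0 : is_derive t 1 f 0.
  apply: (@derive1_at_min R f a b t); first by rewrite ltW // (lt_trans ta).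
  - by move=> s _; case: (df s).
  - by rewrite in_itv.
  - by move=> s; rewrite in_itv /=; exact: H.
by have [_ <-] := df t; have [_ ->] := d0.
Qed.

Lemma first_crossing (R : realType) (u : R -> R) (al t1 : R) :
  continuous u -> 0 <= t1 -> u 0 < al -> al <= u t1 ->
  exists tau, [/\ 0 < tau <= t1, u tau = al & forall s, 0 <= s < tau -> u s < al].
Proof.
move=> cu t10 u0 ut1; pose S := [set t | 0 <= t <= t1 /\ al <= u t].
have infS : has_inf S.
  by split; [exists t1; rewrite /S /= t10 lexx|exists 0 => t [/andP[]]].
pose tau := inf S.
have tau_t1 : tau <= t1 by apply: ge_inf; [case: infS|rewrite /S /= t10 lexx].
have tau0 : 0 <= tau by apply: lb_le_inf; [case: infS|move=> t [/andP[]]].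
have before s : 0 <= s < tau -> u s < al.
  move=> /andP[s0 stau]; rewrite ltNge; apply/negP => als.
  have : tau <= s.
    apply: ge_inf; [by case: infS|split => //].
    by rewrite s0 (le_trans (ltW stau)).
  by rewrite leNgt stau.
have after : al <= u tau.
  rewrite leNgt; apply/negP => ut.
  have al0 : 0 < al - u tau by rewrite subr_gt0.
  have /cvgrPdist_lt /(_ _ al0) [del /= del0 Hd] := cu tau.
  have [t [/andP[t0 tt1] alt] tdel] := inf_adherent del0 infS.
  have taut : tau <= t by apply: ge_inf; [case: infS|split=> //; rewrite t0].
  have := Hd t; rewrite /ball_ /= distrC ger0_norm ?subr_ge0 // ltrBlDl.
  by move=> /(_ tdel) /ltr_normlP[]; lra.
have tau_gt0 : 0 < tau.
  rewrite lt_def tau0 andbT; apply/eqP => tau00.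
  by move: after; rewrite tau00 leNgt u0.
exists tau; split => //; first by rewrite tau_gt0.
apply/eqP; rewrite eq_le after andbT.
apply: (@ler_cvg_to _ (tau^'-) _ _ u (fun=> al)).
- exact: cvg_at_left_filter (cu tau).
- exact: cvg_cst.
- near=> s; apply: ltW; apply: before; apply/andP; split; last first.
    by near: s; exact: nbhs_left_lt.
  by apply/ltW; near: s; exact: nbhs_left_gt.
Unshelve. all: by end_near. Qed.

(** * Powers *)

Lemma powR_pos_continuous (R : realType) (b : R) : 0 < b ->
  continuous (fun x : R => Num.max x 0 `^ b).
Proof.
move=> b0 x; apply/cvgrPdist_le => e e0; have [x0|] := boolP (0 < x); last rewrite -leNgt => x0.
  have cx : {for x, continuous (@powR R ^~ b)}.
    apply: differentiable_continuous; apply/derivable1_diffP.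
    by apply: derivable_powR; rewrite in_itv /= x0.
  move/cvgrPdist_le : cx => /(_ e e0) H.
  near=> y; have y0 : 0 < y by near: y; exact: lt_nbhsr.
  rewrite (max_l (ltW x0)) (max_l (ltW y0)); near: y; exact: H.
have px : Num.max x 0 `^ b = 0 by rewrite max_r // powR0 // gt_eqF.
rewrite px; have d0 : 0 < e `^ b^-1 by exact: powR_gt0.
near=> y; rewrite sub0r normrN ger0_norm ?powR_ge0 //.
have yx : y < e `^ b^-1.
  by near: y; apply: lt_nbhsl; exact: le_lt_trans d0.
have eb : (e `^ b^-1) `^ b = e by rewrite -powRrM mulVf ?gt_eqF // powRr1 // ltW.
rewrite -[leRHS]eb; apply: ge0_ler_powR; first exact: ltW.
- by rewrite nnegrE le_max lexx orbT.
- by rewrite nnegrE ltW.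
- by rewrite ge_max !ltW.
Unshelve. all: by end_near. Qed.

Lemma powR_le_small (R : realType) (b c : R) : 0 < b -> 0 < c ->
  forall x : R, 0 <= x <= c `^ b^-1 -> x `^ b <= c.
Proof.
move=> b0 c0 x /andP[x0 xc].
have cb : (c `^ b^-1) `^ b = c by rewrite -powRrM mulVf ?gt_eqF // powRr1 // ltW.
by rewrite -[leRHS]cb; apply: ge0_ler_powR; rewrite ?nnegrE ?powR_ge0 // ltW.
Qed.

(** The two terms on the right balance when [x] is of the order of
    [y `^ (2 - q)], which fixes the power of [x]; it is the power of the weight
    that is assumed integrable. *)
Lemma young_sublinear (R : realType) (q : R) : 1 < q < 2 ->
  exists2 C, 0 <= C & forall x y : R, 0 <= x -> 0 <= y ->
    (x * y `^ (q - 1)) ^+ 2 <= y ^+ 2 / 64 + C * x `^ (2 / (2 - q)).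
Proof.
move=> /andP[q1 q2]; exists (8 `^ (2 / (2 - q))); first exact: powR_ge0.
move=> x y x0 y0.
have q10 : 0 < q - 1 by rewrite subr_gt0.
have q20 : 0 < 2 - q by rewrite subr_gt0.
have yq0 : 0 <= y `^ (q - 1) by exact: powR_ge0.
have yy : y `^ (2 - q) * y `^ (q - 1) = y.
  have s1 : 2 - q + (q - 1) = 1 by ring.
  by rewrite -powRD s1 ?powRr1 // oner_eq0.
have [xy|xy] := leP (8 * x) (y `^ (2 - q)).
  apply: (@le_trans _ _ (y ^+ 2 / 64)); last first.
    by rewrite lerDl mulr_ge0 // powR_ge0.
  have H : 8 * (x * y `^ (q - 1)) <= y.
    by rewrite mulrA -[leRHS]yy ler_wpM2r.
  have : 0 <= x * y `^ (q - 1) by rewrite mulr_ge0.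
  by move: H; set z := x * _ => *; nra.
apply: (@le_trans _ _ (8 `^ (2 / (2 - q)) * x `^ (2 / (2 - q)))); last first.
  by rewrite lerDr divr_ge0 // sqr_ge0.
have x80 : 0 <= 8 * x by rewrite mulr_ge0.
have x8p : 0 < 8 * x by apply: le_lt_trans xy; exact: powR_ge0.
rewrite -powRM //.
have yx : y `^ (q - 1) <= (8 * x) `^ ((q - 1) / (2 - q)).
  have -> : y `^ (q - 1) = (y `^ (2 - q)) `^ ((q - 1) / (2 - q)).
    by rewrite -powRrM; congr powR; field; rewrite gt_eqF.
  by apply: ge0_ler_powR; rewrite ?nnegrE ?powR_ge0 ?divr_ge0 ?ltW.
have -> : (8 * x) `^ (2 / (2 - q)) = ((8 * x) * (8 * x) `^ ((q - 1) / (2 - q))) ^+ 2.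
  rewrite -powR_mulrn ?mulr_ge0 ?powR_ge0 // -{2}(powRr1 x80) -powRD; last first.
    by rewrite (gt_eqF x8p) implybT.
  by rewrite -powRrM; congr powR; field; rewrite gt_eqF.
rewrite ler_sqr ?nnegrE ?mulr_ge0 ?powR_ge0 //.
by apply: ler_pM => //; rewrite ler_peMl // ler1n.
Qed.

(** * Compactness of approximate solutions *)

Lemma ultra_bounded_cvg (R : realType) (T : Type) (G : set_system T)
    (f : T -> R) (C : R) : UltraFilter G ->
  (\forall n \near G, `|f n| <= C) -> exists x : R, f n @[n --> G] --> x.
Proof.
move=> GU fC; have PG := @ultra_proper _ _ GU.
have [|x [_ clx]] := @segment_compact R (- C) C (f @ G) _.
  by apply: filterS fC => n /=; rewrite in_itv /= -ler_norml.
exists x => V Vx; have [//|nV] := in_ultra_setVsetC (f @^-1` V) GU.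
by have [y [/= nVy Vy]] := clx (~` V) V nV Vx.
Qed.

(** [d] is, up to a time step [h], the slope of [u]: this holds with [h = 0]
    when [d] is the derivative of [u], and for the step functions of an Euler
    scheme of step [h].  It survives a pointwise limit, unlike a derivative. *)
Definition approx_slope (R : realType) (u d : R -> R) (h : R) : Prop :=
  forall s t c e : R, 0 <= s <= t -> 0 <= e ->
    (forall r : R, 0 <= r -> s - h <= r <= t -> `|d r - c| <= e) ->
    `|u t - u s - c * (t - s)| <= e * (t - s) + (`|c| + e) * h.

Lemma is_derive_approx_slope (R : realType) (u d : R -> R) :
  (forall t : R, 0 <= t -> is_derive t 1 u (d t)) -> approx_slope u d 0.
Proof.
move=> H s t c e /andP[s0 st] e0 Hd.
have [x /andP[sx xt]|x /andP[sx xt] ->] := @is_derive_MVT R u d s t st.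
  by apply: H; exact: le_trans sx.
rewrite mulr0 addr0 -mulrBl normrM (ger0_norm (_ : 0 <= t - s)) ?subr_ge0 //.
by rewrite ler_wpM2r ?subr_ge0 // Hd ?subr0 ?sx // (le_trans s0).
Qed.

Lemma approx_slope_lipschitz (R : realType) (u d : R -> R) (h C s t : R) :
  approx_slope u d h -> 0 <= s <= t ->
  (forall r : R, 0 <= r <= t -> `|d r| <= C) -> `|u t - u s| <= C * (t - s + h).
Proof.
move=> H st HC; have /andP[s0 lest] := st.
have C0 : 0 <= C by apply: le_trans (HC 0 _); rewrite ?normr_ge0 ?lexx ?(le_trans s0).
have -> : u t - u s = u t - u s - 0 * (t - s) by ring.
have -> : C * (t - s + h) = C * (t - s) + (`|0 : R| + C) * h by rewrite normr0; ring.
by apply: H => // r r0 /andP[_ rt]; rewrite subr0 HC // r0.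
Qed.

(** Two-sided for [tau > 0], one-sided at the origin: approximate solutions are
    only followed on the half-line. *)
Definition half_line_derivative (R : realType) (f : R -> R) (tau d : R) : Prop :=
  forall e : R, 0 < e -> exists2 del, 0 < del & forall y, 0 <= y ->
    `|y - tau| < del -> `|f y - f tau - d * (y - tau)| <= e * `|y - tau|.

Lemma approx_slope_limit (R : realType) (G : set_system nat)
    (u_ d_ : nat -> R -> R) (h_ : nat -> R) (u : R -> R) (tau c : R) :
  ProperFilter G -> h_ n @[n --> G] --> 0 ->
  (forall t : R, 0 <= t -> u_ n t @[n --> G] --> u t) ->
  (forall n, approx_slope (u_ n) (d_ n) (h_ n)) -> 0 <= tau ->
  (forall e : R, 0 < e -> exists2 del, 0 < del & \forall n \near G,
     forall r : R, 0 <= r -> `|r - tau| < del -> `|d_ n r - c| <= e) ->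
  half_line_derivative u tau c.
Proof.
move=> PG h0 uu slope tau0 Hd e e0; have [del del0 Hdel] := Hd e e0.
have del20 : 0 < del / 2 by rewrite divr_gt0.
exists (del / 2) => //.
have main (a b : R) : 0 <= a <= b -> `|a - tau| < del / 2 -> `|b - tau| < del / 2 ->
    `|u b - u a - c * (b - a)| <= e * (b - a).
  move=> ab /ltr_normlP[a1 a2] /ltr_normlP[b1 b2].
  have /andP[a0 leab] := ab; have b0 : 0 <= b := le_trans a0 leab.
  apply: (@ler_cvg_to _ G _ _ (fun n => `|u_ n b - u_ n a - c * (b - a)|)
    (fun n => e * (b - a) + (`|c| + e) * h_ n)).
  - apply: cvg_norm; apply: cvgB; last exact: cvg_cst.
    by apply: cvgB; exact: uu.
  - rewrite -[X in _ --> X]addr0; apply: cvgD; first exact: cvg_cst.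
    by rewrite -[X in _ --> X](mulr0 (`|c| + e)); apply: cvgM => //; exact: cvg_cst.
  - have hsmall : \forall n \near G, h_ n < del / 2.
      by move/cvgrPdist_lt : h0 => /(_ _ del20); apply: filterS => n;
         rewrite sub0r normrN => /(le_lt_trans (ler_norm _)).
    near=> n; apply: slope => //; first exact: ltW.
    move=> r r0 /andP[r1 r2].
    have hn : h_ n < del / 2 by near: n.
    have Hn : forall r : R, 0 <= r -> `|r - tau| < del -> `|d_ n r - c| <= e.
      by near: n.
    apply: Hn => //; apply/ltr_normlP; clear - r1 r2 hn a1 a2 b1 b2 del20.
    by split; lra.
move=> y y0 yt; have t0 : `|tau - tau| < del / 2 by rewrite subrr normr0.
have [tauy|/ltW ytau] := leP tau y.
  by rewrite (ger0_norm (_ : 0 <= y - tau)) ?subr_ge0 //; apply: main; rewrite ?tau0.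
rewrite (ler0_norm (_ : y - tau <= 0)) ?subr_le0 //.
have -> : u y - u tau - c * (y - tau) = - (u tau - u y - c * (tau - y)) by ring.
by rewrite normrN opprB; apply: main; rewrite ?y0.
Unshelve. all: by end_near. Qed.

Lemma continuous3P (R : realType) (F : R -> R -> R -> R) :
  continuous (fun z : R * R * R => F z.1.1 z.1.2 z.2) ->
  forall t x y e, 0 < e -> exists2 del, 0 < del & forall t' x' y',
    `|t' - t| < del -> `|x' - x| < del -> `|y' - y| < del ->
    `|F t' x' y' - F t x y| <= e.
Proof.
move=> cF t x y e e0; have /cvgrPdist_le /(_ e e0) := cF (t, x, y).
move=> /nbhs_ballP[del /= del0 H]; exists del => // t' x' y' Ht Hx Hy.
rewrite distrC; apply: (H (t', x', y')).
by split; [split|]; rewrite /ball /= distrC.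
Qed.

(** Along an ultrafilter bounded sequences converge, so no subsequence has to
    be extracted; the slopes being bounded, the approximate solutions are
    equi-Lipschitz up to [h_], which turns pointwise convergence into
    convergence of the slopes near each point. *)
Lemma ode_compactness (R : realType) (F K : R -> R -> R -> R)
    (u_ w_ : nat -> R -> R) (h_ eta_ : nat -> R) :
  continuous (fun z : R * R * R => F z.1.1 z.1.2 z.2) ->
  continuous (fun z : R * R * R => K z.1.1 z.1.2 z.2) ->
  h_ n @[n --> \oo] --> 0 -> eta_ n @[n --> \oo] --> 0 ->
  (forall n, approx_slope (u_ n) (fun r => F r (u_ n r) (w_ n r)) (h_ n)) ->
  (forall n,
     approx_slope (w_ n) (fun r => K r (u_ n r) (w_ n r) - eta_ n) (h_ n)) ->
  (forall T, exists C, \forall n \near \oo, forall r : R, 0 <= r <= T ->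
     [/\ `|u_ n r| <= C, `|w_ n r| <= C, `|F r (u_ n r) (w_ n r)| <= C &
         `|K r (u_ n r) (w_ n r) - eta_ n| <= C]) ->
  exists G : set_system nat, exists u w : R -> R,
  [/\ ProperFilter G, \oo `<=` G,
      forall t : R, 0 <= t -> u_ n t @[n --> G] --> u t,
      forall t : R, 0 <= t -> w_ n t @[n --> G] --> w t &
      forall t : R, 0 <= t -> half_line_derivative u t (F t (u t) (w t)) /\
                          half_line_derivative w t (K t (u t) (w t))].
Proof.
move=> cF cK h0 eta0 slu slw bnd.
have [G [GU oG]] := @ultraFilterLemma nat \oo _.
have PG := @ultra_proper _ _ GU.
have ex (v_ : nat -> R -> R) : (forall t : R, 0 <= t -> exists C, \forall n \near \oo,
    `|v_ n t| <= C) -> exists v : R -> R, forall t : R, 0 <= t -> v_ n t @[n --> G] --> v t.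
  move=> Hv; have /choice[v vP] : forall t : R, exists x : R, 0 <= t ->
      v_ n t @[n --> G] --> x.
    move=> t; have [t0|tn] := boolP (0 <= t); last by exists 0.
    have [C HC] := Hv t t0.
    have [x Hx] := @ultra_bounded_cvg R nat G (v_ ^~ t) C GU (oG _ HC).
    by exists x.
  by exists v.
have [|u Hu] := ex u_.
  move=> t t0; have [C HC] := bnd t; exists C; apply: filterS HC => n.
  by move=> /(_ t); rewrite t0 lexx => /(_ isT)[].
have [|w Hw] := ex w_.
  move=> t t0; have [C HC] := bnd t; exists C; apply: filterS HC => n.
  by move=> /(_ t); rewrite t0 lexx => /(_ isT)[].
have h0G : h_ n @[n --> G] --> 0 by apply: cvg_trans h0 => A; exact: oG.
have eta0G : eta_ n @[n --> G] --> 0 by apply: cvg_trans eta0 => A; exact: oG.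
exists G, u, w; split => // tau tau0.
have [C HC] := bnd (tau + 1).
pose D := `|C| + 1.
have D0 : 0 < D by rewrite ltr_wpDl.
(* The slopes are bounded by [D], up to [h_]: convergence at [tau] alone
   controls the sequence on a whole neighbourhood. *)
have near_tau del : 0 < del -> exists2 rho, 0 < rho & \forall n \near G,
    forall r : R, 0 <= r -> `|r - tau| < rho ->
      [/\ `|r - tau| < del, `|u_ n r - u tau| < del & `|w_ n r - w tau| < del].
  move=> del0; pose rho := Num.min 1 (del / (4 * D)).
  have q0 : 0 < del / (4 * D) by rewrite divr_gt0 ?mulr_gt0.
  have Dq : D * (del / (4 * D)) = del / 4 by field; rewrite gt_eqF.
  have rho0 : 0 < rho by rewrite lt_min ltr01 q0.
  exists rho => //; near=> n => r r0 rtau.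
  have /andP[rtau1 rtau2] : (`|r - tau| < 1) && (`|r - tau| < del / (4 * D)).
    by rewrite -lt_min.
  have Hn : forall r : R, 0 <= r <= tau + 1 ->
     [/\ `|u_ n r| <= C, `|w_ n r| <= C, `|F r (u_ n r) (w_ n r)| <= C &
         `|K r (u_ n r) (w_ n r) - eta_ n| <= C] by near: n; exact: oG.
  have hn : `|0 - h_ n| < del / (4 * D).
    by near: n; move/cvgrPdist_lt : h0G; apply.
  have un : `|u tau - u_ n tau| < del / 4.
    by near: n; move/cvgrPdist_lt : (Hu tau tau0); apply; rewrite divr_gt0.
  have wn : `|w tau - w_ n tau| < del / 4.
    by near: n; move/cvgrPdist_lt : (Hw tau tau0); apply; rewrite divr_gt0.
  have lip v d : approx_slope v d (h_ n) ->
      (forall r : R, 0 <= r <= tau + 1 -> `|d r| <= C) ->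
      `|v r - v tau| <= del / 2.
    move=> slv dC.
    have dD x : 0 <= x <= tau + 1 -> `|d x| <= D.
      move=> /dC /le_trans; apply; rewrite /D (le_trans (ler_norm C)) // lerDl //.
    have h1 : h_ n < del / (4 * D).
      by move: hn; rewrite sub0r normrN => /(le_lt_trans (ler_norm _)).
    move: rtau1 rtau2 => /ltr_normlP[a1 a2] /ltr_normlP[b1 b2].
    have [taur|/ltW rt] := leP tau r.
      apply: le_trans (approx_slope_lipschitz (C := D) slv _ _) _.
      - by rewrite tau0.
      - move=> x /andP[x0 xr]; apply: dD; rewrite x0 /= (le_trans xr) //.
        by clear - a2; lra.
      apply: (le_trans (ler_wpM2l (ltW D0) (lerD (ltW b2) (ltW h1)))).
      by rewrite mulrDr Dq; clear; lra.
    rewrite distrC; apply: le_trans (approx_slope_lipschitz (C := D) slv _ _) _.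
    - by rewrite r0.
    - move=> x /andP[x0 xr]; apply: dD; rewrite x0 /= (le_trans xr) //.
      by rewrite lerDl.
    rewrite opprB in b1.
    apply: (le_trans (ler_wpM2l (ltW D0) (lerD (ltW b1) (ltW h1)))).
    by rewrite mulrDr Dq; clear; lra.
  split.
  - apply: lt_le_trans rtau2 _; rewrite ler_pdivrMr ?mulr_gt0 // ler_peMr 1?ltW //.
    have : 0 <= `|C| by []. by rewrite /D; clear; lra.
  - have lu : `|u_ n r - u_ n tau| <= del / 2.
      by apply: (lip _ _ (slu n)) => x /Hn[].
    rewrite distrC in un; have := ler_distD (u_ n tau) (u_ n r) (u tau).
    by clear - un lu del0; lra.
  - have lw : `|w_ n r - w_ n tau| <= del / 2.
      by apply: (lip _ _ (slw n)) => x /Hn[].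
    rewrite distrC in wn; have := ler_distD (w_ n tau) (w_ n r) (w tau).
    by clear - wn lw del0; lra.
split.
  apply: (approx_slope_limit PG h0G Hu slu) => // e e0.
  have [del del0 Hdel] := continuous3P cF tau (u tau) (w tau) e0.
  have [rho rho0 Hrho] := near_tau del del0; exists rho => //.
  apply: filterS Hrho => n Hn r r0 rtau; have [? ? ?] := Hn r r0 rtau.
  exact: Hdel.
apply: (approx_slope_limit PG h0G Hw slw) => // e e0.
have e20 : 0 < e / 2 by rewrite divr_gt0.
have [del del0 Hdel] := continuous3P cK tau (u tau) (w tau) e20.
have [rho rho0 Hrho] := near_tau del del0; exists rho => //.
near=> n => r r0 rtau.
have Hn : forall r : R, 0 <= r -> `|r - tau| < rho ->
      [/\ `|r - tau| < del, `|u_ n r - u tau| < del & `|w_ n r - w tau| < del].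
  by near: n.
have en : `|0 - eta_ n| < e / 2 by near: n; move/cvgrPdist_lt : eta0G; apply.
have [q1 q2 q3] := Hn r r0 rtau; have := Hdel _ _ _ q1 q2 q3.
move: en => /ltr_normlP[e1 e2] /ler_normlP[k1 k2].
by apply/ler_normlP; clear - e1 e2 k1 k2; split; lra.
Unshelve. all: by end_near. Qed.

(** Reflection turns a solution on the half-line into one on the line; the
    condition [w 0 = 0] matches the one-sided derivatives of [u] at the origin. *)
Lemma reflect_solution (R : realType) (F K : R -> R -> R -> R) (u w : R -> R) :
  (forall t x y, F (- t) x (- y) = - F t x y) ->
  (forall t x y, K (- t) x (- y) = K t x y) ->
  w 0 = 0 ->
  (forall t : R, 0 <= t -> half_line_derivative u t (F t (u t) (w t)) /\
                       half_line_derivative w t (K t (u t) (w t))) ->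
  exists U W : R -> R,
  [/\ forall t : R, 0 <= t -> U t = u t /\ W t = w t,
      forall t : R, U (- t) = U t, forall t : R, W (- t) = - W t,
      forall t : R, is_derive t 1 U (F t (U t) (W t)) &
      forall t : R, is_derive t 1 W (K t (U t) (W t))].
Proof.
move=> oddF evenK w0 H.
pose U (t : R) : R := u `|t|; pose W (t : R) : R := if 0 <= t then w t else - w (- t).
have UW (t : R) : 0 <= t -> U t = u t /\ W t = w t.
  by move=> t0; rewrite /U /W ger0_norm // t0.
have evU t : U (- t) = U t by rewrite /U normrN.
have odW t : W (- t) = - W t.
  rewrite /W oppr_ge0; have [t0|t0|->] := ltrgtP t 0; rewrite ?opprK //.
  by rewrite oppr0 w0 oppr0.
have mirror (V : R -> R) (k t d : R) :
    k * k = 1 -> (forall s, V (- s) = k * V s) ->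
    is_derive t 1 V d -> is_derive (- t) 1 V (- k * d).
  move=> k1 HV /is_derive1P Hd; apply/is_derive1P => e e0.
  have nk : `|k| = 1.
    by apply/eqP; rewrite -(@eqrXn2 _ 2) // -normrX expr2 k1 normr1 expr1n.
  have [del del0 Hdel] := Hd e e0; exists del => // y.
  have -> : y - - t = - ((- y) - t) by ring.
  rewrite normrN => /Hdel; rewrite !HV.
  have -> : V y - k * V t - - k * d * - (- y - t) =
     k * (k * V y - V t - d * (- y - t)) - (k * k - 1) * V y by ring.
  by rewrite k1 subrr mul0r subr0 normrM nk mul1r.
have pos (V v : R -> R) (d t : R) : 0 < t -> (forall s : R, 0 <= s -> V s = v s) ->
    half_line_derivative v t d -> is_derive t 1 V d.
  move=> t0 Vv Hd; apply/is_derive1P => e e0; have [del del0 Hdel] := Hd e e0.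
  exists (Num.min del t); first by rewrite lt_min del0.
  move=> y; rewrite lt_min => /andP[y1 /ltr_normlP[y2 y3]].
  by rewrite !Vv ?(ltW t0) //; [apply: Hdel => //|]; lra.
have at0 (V v : R -> R) (k d : R) : k * k = 1 -> - k * d = d -> k * V 0 = V 0 ->
    (forall s : R, 0 <= s -> V s = v s) -> (forall s, V (- s) = k * V s) ->
    half_line_derivative v 0 d -> is_derive (0 : R) 1 V d.
  move=> k1 kd k0 Vv HV Hd; apply/is_derive1P => e e0.
  have nk : `|k| = 1.
    by apply/eqP; rewrite -(@eqrXn2 _ 2) // -normrX expr2 k1 normr1 expr1n.
  have [del del0 Hdel] := Hd e e0; exists del => // y yd.
  have [y0|/ltW y0] := leP 0 y; first by rewrite !Vv //; exact: Hdel.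
  have y0' : 0 <= - y by rewrite oppr_ge0.
  have := Hdel (- y) y0'; rewrite !subr0 normrN in yd *.
  rewrite -!Vv // HV => /(_ yd).
  have -> : k * V y - V 0 - d * - y = k * (V y - V 0 - d * y)
    + (k * V 0 - V 0) + (d - - k * d) * y by ring.
  by rewrite kd k0 !subrr mul0r !addr0 normrM nk mul1r.
have nn : -1 * -1 = 1 :> R by rewrite mulrNN mulr1.
exists U, W; split => // t.
- have [t0|t0|t0] := ltrgtP 0 t.
  + have [-> ->] := UW _ (ltW t0); have [HU _] := H t (ltW t0).
    by apply: (pos U u) => // s /UW[].
  + have nt0 : 0 < - t by rewrite oppr_gt0.
    have [HU _] := H _ (ltW nt0).
    have /(mirror U 1 (- t) _ (mul1r 1)) := pos U u _ _ nt0 (fun s s0 => (UW s s0).1) HU.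
    rewrite opprK => Hm; have := Hm (fun s => _).
    have [<- <-] := UW _ (ltW nt0); rewrite mulN1r -oddF opprK -odW opprK evU.
    by apply => s; rewrite mul1r.
  + rewrite -t0; have [-> ->] := UW _ (lexx 0); have [HU _] := H _ (lexx 0).
    apply: (at0 U u 1) => //; rewrite ?mul1r //; last 2 first.
    * by move=> s /UW[].
    * by move=> s; rewrite mul1r.
    by rewrite mulN1r -oddF oppr0 w0 oppr0.
- have [t0|t0|t0] := ltrgtP 0 t.
  + have [-> ->] := UW _ (ltW t0); have [_ HW] := H t (ltW t0).
    by apply: (pos W w) => // s /UW[].
  + have nt0 : 0 < - t by rewrite oppr_gt0.
    have [_ HW] := H _ (ltW nt0).
    have /(mirror W (-1) (- t) _ nn) := pos W w _ _ nt0 (fun s s0 => (UW s s0).2) HW.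
    rewrite !opprK => Hm; have := Hm (fun s => _).
    have [<- <-] := UW _ (ltW nt0); rewrite mul1r evU odW evenK.
    by apply => s; rewrite mulN1r.
  + rewrite -t0; have [-> ->] := UW _ (lexx 0); have [_ HW] := H _ (lexx 0).
    apply: (at0 W w (-1)) => //; rewrite ?mulN1r ?mulrNN ?mulr1 ?opprK //.
    * by rewrite mul1r.
    * by rewrite -odW oppr0.
    * by move=> s /UW[].
    * by move=> s; rewrite mulN1r.
Qed.

(** * A boundary value problem by shooting *)

Lemma continuous3_comp (R : realType) (T : topologicalType)
    (F : R -> R -> R -> R) (f g k : T -> R) :
  continuous (fun z : R * R * R => F z.1.1 z.1.2 z.2) ->
  continuous f -> continuous g -> continuous k ->
  continuous (fun a => F (f a) (g a) (k a)).
Proof.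
move=> cF cf cg ck a.
apply: (@continuous_comp _ _ _ (fun a => (f a, g a, k a))
  (fun z : R * R * R => F z.1.1 z.1.2 z.2)); last exact: cF.
apply: (@cvg_pair _ _ _ (nbhs a) (nbhs (f a, g a)) (nbhs (k a))); last exact: ck.
by apply: (@cvg_pair _ _ _ (nbhs a) (nbhs (f a)) (nbhs (g a)));
  [exact: cf|exact: cg].
Qed.

Fixpoint euler (R : realType) (A : R -> R) (F : R -> R -> R -> R) (h a : R)
    (k : nat) : R * R :=
  if k is j.+1 then
    let z := euler A F h a j in
    (z.1 + h * (z.2 / A z.1), z.2 + h * (z.1 - F (h * j%:R) z.1 z.2))
  else (a, 0).

Lemma euler_continuous (R : realType) (A : R -> R) (F : R -> R -> R -> R)
    (h : R) (k : nat) :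
  continuous A -> (forall x, A x != 0) ->
  continuous (fun z : R * R * R => F z.1.1 z.1.2 z.2) ->
  continuous (fun a => (euler A F h a k).1) /\
  continuous (fun a => (euler A F h a k).2).
Proof.
move=> cA A0 cF; elim: k => [|k [IH1 IH2]] /=.
  by split => a; [exact: cvg_id|exact: cvg_cst].
split => a.
- apply: cvgD; first exact: IH1.
  apply: cvgM; first exact: cvg_cst.
  apply: cvgM; first exact: IH2.
  apply: cvgV; first exact: A0.
  by apply: continuous_comp; [exact: IH1|exact: cA].
- apply: cvgD; first exact: IH2.
  apply: cvgM; first exact: cvg_cst.
  apply: cvgB; first exact: IH1.
  by apply: continuous3_comp => // b; exact: cvg_cst.
Qed.

Lemma euler_le0 (R : realType) (A : R -> R) (F : R -> R -> R -> R) (h : R) k :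
  0 <= h -> (forall x, 0 < A x) -> (forall t x y, 0 <= F t x y) ->
  (euler A F h 0 k).1 <= 0 /\ (euler A F h 0 k).2 <= 0.
Proof.
move=> h0 A0 F0; elim: k => [|k [IH1 IH2]] //=.
set x := (euler _ _ _ _ _).1 in IH1 *; set y := (euler _ _ _ _ _).2 in IH2 *.
split; rewrite -[leRHS]addr0 lerD // mulr_ge0_le0 //.
  by rewrite mulr_le0_ge0 // invr_ge0 ltW.
by rewrite subr_le0 (le_trans IH1) // F0.
Qed.

Lemma euler_ge (R : realType) (A : R -> R) (F : R -> R -> R -> R) (h B T : R) k :
  0 <= h -> (forall x, 0 < A x) ->
  (forall t x y, 0 <= t <= T -> F t x y <= B) -> h * k%:R <= T ->
  B <= (euler A F h B k).1 /\ 0 <= (euler A F h B k).2.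
Proof.
move=> h0 A0 FB; elim: k => [|k IH] //= kT.
have kT' : h * k%:R <= T by apply: le_trans kT; rewrite ler_wpM2l // ler_nat.
have [IH1 IH2] := IH kT'.
set x := (euler _ _ _ _ _).1 in IH1 *; set y := (euler _ _ _ _ _).2 in IH2 *.
split.
  by rewrite -[leLHS]addr0 lerD // !mulr_ge0 // invr_ge0 ltW.
rewrite addr_ge0 // mulr_ge0 // subr_ge0 (le_trans _ IH1) // FB //.
by rewrite mulr_ge0.
Qed.

(** The bound depends on [h] and [k] only through the time [h * k], which allows
    the step to tend to 0. *)
Lemma euler_growth (R : realType) (A : R -> R) (F : R -> R -> R -> R)
    (gamma h a B T : R) k :
  0 <= h -> 0 < gamma <= 1 -> (forall x, gamma <= A x) -> 0 <= a ->
  (forall t x y, 0 <= t <= T -> 0 <= F t x y <= B) -> h * k%:R <= T ->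
  `|(euler A F h a k).1| + `|(euler A F h a k).2| + gamma * B <=
  expR (h * k%:R / gamma) * (a + gamma * B).
Proof.
move=> h0 /andP[g0 g1] Ag a0 FB; elim: k => [|k IH] kT.
  by rewrite /= normr0 addr0 ger0_norm // mulr0 mul0r expR0 mul1r.
have kT' : h * k%:R <= T by apply: le_trans kT; rewrite ler_wpM2l // ler_nat.
have {}IH := IH kT'.
rewrite /=.
set x := (euler _ _ _ _ _).1 in IH *; set y := (euler _ _ _ _ _).2 in IH *.
have /andP[F0 FB'] : 0 <= F (h * k%:R) x y <= B by apply: FB; rewrite mulr_ge0.
have B0 : 0 <= B by apply: le_trans FB'.
have -> : h * k.+1%:R / gamma = h / gamma + h * k%:R / gamma.
  by rewrite -natr1; ring.
rewrite expRD -mulrA.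
set Y := expR _ * (a + _) in IH *.
have E1 : 1 + h / gamma <= expR (h / gamma) by exact: expR_ge1Dx.
have hg : 0 <= h / gamma by rewrite divr_ge0 // ltW.
have hhg : h <= h / gamma by rewrite ler_pdivlMr // ler_piMr.
have Y0 : 0 <= Y.
  by rewrite mulr_ge0 ?expR_ge0 // addr_ge0 // mulr_ge0 // ltW.
apply: le_trans (ler_wpM2r Y0 E1).
have hgB : h / gamma * (gamma * B) = h * B by field; rewrite gt_eqF.
have Ax : 0 < A x := lt_le_trans g0 (Ag x).
have n1 : `|h * (y / A x)| <= h / gamma * `|y|.
  rewrite !normrM (ger0_norm h0) -mulrA ler_wpM2l // mulrC.
  by rewrite ler_wpM2r // normfV lef_pV2 ?posrE ?normr_gt0 ?gt_eqF // gtr0_norm.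
have n2 : `|h * (x - F (h * k%:R) x y)| <= h / gamma * `|x| + h * B.
  rewrite normrM (ger0_norm h0); apply: (@le_trans _ _ (h * (`|x| + B))).
    rewrite ler_wpM2l // (le_trans (ler_normB _ _)) // lerD2l ger0_norm //.
  by rewrite mulrDr lerD2r ler_wpM2r.
have := ler_normD x (h * (y / A x)).
have := ler_normD y (h * (x - F (h * k%:R) x y)).
have : (1 + h / gamma) * (`|x| + `|y| + gamma * B) <= (1 + h / gamma) * Y.
  by rewrite ler_wpM2l // addr_ge0.
move: n1 n2 hgB.
set n := `|h * (x - _)|; set n' := `|h * (y / _)|; set b := gamma * B.
set hh := h / gamma => *; nra.
Qed.

Lemma step_approx_slope (R : realType) (x : nat -> R) (d : R -> R) (h : R) :
  0 < h -> (forall k, x k.+1 = x k + h * d (h * k%:R)) ->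
  approx_slope (fun t => x (Num.truncn (t / h))) d h.
Proof.
move=> h0 xS s t c e /andP[s0 st] e0 Hd.
have t0 := le_trans s0 st.
have /andP[i1 i2] := truncn_itv (divr_ge0 s0 (ltW h0)).
have /andP[j1 j2] := truncn_itv (divr_ge0 t0 (ltW h0)).
have ij : (Num.truncn (s / h) <= Num.truncn (t / h))%N.
  by apply: le_truncn; rewrite ler_pM2r // invr_gt0.
move: i1 i2 j1 j2 ij.
set i := Num.truncn _; set j := Num.truncn _.
rewrite ler_pdivlMr // ltr_pdivrMr // ler_pdivlMr // ltr_pdivrMr //.
move=> i1 i2 j1 j2 ij.
have steps m : (i + m <= j)%N ->
    `|x (i + m)%N - x i - c * (h * m%:R)| <= e * (h * m%:R).
  elim: m => [|m IH] imj; first by rewrite addn0 subrr !mulr0 subr0 normr0.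
  rewrite addnS in imj *; have {}IH := IH (ltnW imj).
  rewrite xS.
  have /ler_normlP[d1 d2] : `|d (h * (i + m)%:R) - c| <= e.
    have him : h * (i + m)%:R <= t.
      by apply: le_trans j1; rewrite mulrC ler_pM2r // ler_nat ltnW.
    apply: Hd; first by rewrite mulr_ge0 // ltW.
    rewrite him andbT natrD mulrDr.
    have : 0 <= h * m%:R by rewrite mulr_ge0 // ltW.
    by move: i2; rewrite -natr1 mulrDl mul1r; lra.
  move: IH => /ler_normlP[a1 a2]; rewrite -natr1.
  move: a1 a2 d1 d2; set D := d _; set X := x (_ + _)%N => a1 a2 d1 d2.
  apply/ler_normlP; split; nra.
have := steps (j - i)%N; rewrite subnKC // leqnn natrB // => /(_ isT).
have hm : `|h * (j%:R - i%:R) - (t - s)| <= h.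
  rewrite -natr1 mulrDl mul1r in i2; rewrite -natr1 mulrDl mul1r in j2.
  by apply/ler_normlP; split; lra.
set m := h * _ in hm * => Hx.
have -> : x j - x i - c * (t - s) = (x j - x i - c * m) + c * (m - (t - s)) by ring.
apply: le_trans (ler_normD _ _) _; rewrite normrM.
have : `|c| * `|m - (t - s)| <= `|c| * h by rewrite ler_wpM2l.
move: hm => /ler_normlP[_ hm].
have : e * m <= e * (t - s + h) by rewrite ler_wpM2l //; lra.
by move: Hx; lra.
Qed.

(** The terminal value of the Euler scheme is a continuous function of the
    initial value [a]; it is nonpositive for [a = 0] and, where [F] is bounded
    by [B], nonnegative for [a = B].  The intermediate value theorem thus
    solves the discrete boundary value problem; no uniqueness for the initial
    value problem is involved. *)
Lemma bvp_exists (R : realType) (A : R -> R) (F : R -> R -> R -> R)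
    (gamma T : R) :
  0 < gamma < 1 -> (forall x, gamma <= A x) -> continuous A ->
  continuous (fun z : R * R * R => F z.1.1 z.1.2 z.2) ->
  (forall t x y, 0 <= F t x y) ->
  (forall S, exists B, forall t x y, 0 <= t <= S -> F t x y <= B) ->
  (forall t x y, F (- t) x (- y) = F t x y) -> 0 < T ->
  exists u w : R -> R,
  [/\ forall t, u (- t) = u t, forall t, w (- t) = - w t,
      forall t : R, is_derive t 1 u (w t / A (u t)),
      forall t : R, is_derive t 1 w (u t - F t (u t) (w t)) & u T = 0].
Proof.
move=> /andP[g0 g1] Ag cA cF F0 FB evF T0.
have Apos x : 0 < A x := lt_le_trans g0 (Ag x).
(* The step divides [T], so that [T] is a node of the scheme. *)
pose h_ n := T / n.+1%:R.
have h_gt0 n : 0 < h_ n by rewrite divr_gt0.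
have hN n : h_ n * n.+1%:R = T by rewrite /h_ divfK.
have [B HB] := FB T.
have B0 : 0 <= B by apply: le_trans (F0 0 0 0) (HB 0 0 0 _); rewrite lexx ltW.
have Hshoot n : exists a, (0 <= a <= B) /\ (euler A F (h_ n) a n.+1).1 = 0.
  have cont := (@euler_continuous R A F (h_ n) n.+1 cA (fun x => lt0r_neq0 (Apos x)) cF).1.
  have [||a] := @IVT R (fun a => (euler A F (h_ n) a n.+1).1) 0 B 0 B0.
  - exact: continuous_subspaceT.
  - have e1 := (euler_le0 n.+1 (ltW (h_gt0 n)) Apos F0).1.
    have e2 : B <= (euler A F (h_ n) B n.+1).1.
      by apply: (euler_ge (T := T) (ltW (h_gt0 n)) Apos HB _).1; rewrite hN.
    by rewrite ge_min e1 /= le_max (le_trans B0 e2) orbT.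
  - by rewrite in_itv /= => aB E; exists a.
have {Hshoot} /choice[al Hal] := Hshoot.
pose k_ n (t : R) := Num.truncn (t / h_ n).
pose u_ n t := (euler A F (h_ n) (al n) (k_ n t)).1.
pose w_ n t := (euler A F (h_ n) (al n) (k_ n t)).2.
have k_grid n k : k_ n (h_ n * k%:R) = k.
  by apply: truncn_def; rewrite mulrAC mulfV ?gt_eqF // mul1r lexx ltr_nat /=.
have k0 n : k_ n 0 = 0%N by rewrite -(k_grid n 0%N) mulr0.
have [||||||| G [u [w [PG oG uu ww Hder]]]] := @ode_compactness R
  (fun t x y => y / A x) (fun t x y => x - F t x y) u_ w_ h_ (fun=> 0).
- move=> z; apply: cvgM; first exact: cvg_snd.
  apply: cvgV; first by rewrite gt_eqF.
  apply: (@continuous_comp _ _ _ (fun z : R * R * R => z.1.2)); last exact: cA.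
  apply: (@continuous_comp _ _ _ (fun z : R * R * R => z.1));
  [exact: cvg_fst|exact: cvg_snd].
- move=> z; apply: cvgB; last exact: cF.
  apply: (@continuous_comp _ _ _ (fun z : R * R * R => z.1));
  [exact: cvg_fst|exact: cvg_snd].
- rewrite -[X in _ --> X](mulr0 T); apply: cvgM; first exact: cvg_cst.
  exact: cvg_harmonic.
- exact: cvg_cst.
- move=> n; apply: (@step_approx_slope R (fun k => (euler A F (h_ n) (al n) k).1)) => //.
  by move=> k; rewrite /u_ /w_ k_grid.
- move=> n; apply: (@step_approx_slope R (fun k => (euler A F (h_ n) (al n) k).2)) => //.
  by move=> k; rewrite /u_ /w_ k_grid subr0.
- move=> S; have [S0|S0] := ltP S 0.
    exists 0; apply: nearW => n r /andP[r0 rS].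
    by have := le_lt_trans (le_trans r0 rS) S0; rewrite ltxx.
  have [B' HB'] := FB S.
  have B'0 : 0 <= B' by apply: le_trans (F0 0 0 0) (HB' 0 0 0 _); rewrite lexx.
  pose M := expR (S / gamma) * (B + gamma * B').
  have M0 : 0 <= M by rewrite mulr_ge0 ?expR_ge0 // addr_ge0 // mulr_ge0 // ltW.
  have gM : M <= M / gamma by rewrite ler_pdivlMr // ler_piMr // ltW.
  exists (M / gamma + B'); apply: nearW => n r /andP[r0 rS].
  have kr : h_ n * (k_ n r)%:R <= r.
    by rewrite mulrC -ler_pdivlMr // truncn_le divr_ge0 // ltW.
  have [/andP[al0 alB] _] := Hal n.
  have bnd : `|u_ n r| + `|w_ n r| <= M.
    have g01 : 0 < gamma <= 1 by rewrite g0 ltW.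
    have FB' t x y : 0 <= t <= S -> 0 <= F t x y <= B'.
      by move=> tS; rewrite F0 HB'.
    have H := euler_growth (ltW (h_gt0 n)) g01 Ag al0 FB' (le_trans kr rS).
    have gB : 0 <= gamma * B' by rewrite mulr_ge0 // ltW.
    apply: (@le_trans _ _ (expR (h_ n * (k_ n r)%:R / gamma) * (al n + gamma * B'))).
      by apply: le_trans H; rewrite lerDl.
    rewrite ler_pM ?expR_ge0 ?addr_ge0 // ?lerD2r //.
    by rewrite ler_expR ler_pM2r ?invr_gt0 // (le_trans kr).
  have un : `|u_ n r| <= M by apply: le_trans bnd; rewrite lerDl.
  have wn : `|w_ n r| <= M by apply: le_trans bnd; rewrite lerDr.
  split.
  + by apply: le_trans un _; apply: le_trans gM _; rewrite lerDl.
  + by apply: le_trans wn _; apply: le_trans gM _; rewrite lerDl.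
  + apply: (@le_trans _ _ (M / gamma)); last by rewrite lerDl.
    rewrite normrM normfV (gtr0_norm (Apos _)) ler_pM // ?invr_ge0 ?lef_pV2 ?posrE //.
    exact: ltW.
  + rewrite subr0 (le_trans (ler_normB _ _)) // lerD ?(le_trans un) //.
    by rewrite ger0_norm // HB' // r0.
have w0 : w 0 = 0.
  apply/esym; apply: (cvg_unique _ (_ : (fun=> 0 : R) @ G --> (0 : R)) _) => //.
    exact: cvg_cst.
  have := ww 0 (lexx 0); have -> // : w_^~ 0 = fun=> 0.
  by apply/funext => n; rewrite /w_ k0.
have [||U [W [UW evU odW dU dW]]] := @reflect_solution R
  (fun t x y => y / A x) (fun t x y => x - F t x y) u w _ _ w0 Hder.
- by move=> t x y; rewrite mulNr.
- by move=> t x y; rewrite evF.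
exists U, W; split => //.
have [-> _] := UW T (ltW T0).
apply: (cvg_unique _ (uu T (ltW T0)) _) => //.
have -> // : u_^~ T = fun=> 0; last exact: cvg_cst.
by apply/funext => n; rewrite /u_ -{1}(hN n) k_grid; case: (Hal n).
Qed.

(** * A priori estimates *)

Section Model.
Context (R : realType) (q p gamma eps : R) (A a g : R -> R).
Hypotheses (q12 : 1 < q < 2) (p2 : 2 < p) (gamma01 : 0 < gamma < 1).
Hypotheses (A_ge : forall x, gamma <= A x) (A_cont : continuous A)
  (A_mono : {homo A : x y / x <= y}).
Hypotheses (a_cont : continuous a) (a_pos : forall t, 0 < a t)
  (a_even : even_function a).
Hypothesis g_cont : continuous g.
Hypotheses (eps01 : 0 < eps <= 1) (eps_p : eps `^ (p - 2) <= 1 / 8)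
  (eps_g : forall s : R, 0 <= s <= eps -> 0 <= g s <= gamma / 4 * s).

Local Notation r := (2 / (2 - q)).

Definition clamp (x : R) : R := Num.min (Num.max x 0) eps.

(** The right-hand side of the equation, truncated at the level [eps] so that
    it is bounded on bounded time intervals and its superlinear terms have small
    constants, and raised by [eta] so that the zero function is not a
    solution. *)
Definition source (lam eta t x y : R) : R :=
  lam * a t * clamp x `^ (q - 1) + clamp x `^ (p - 1) +
  g (Num.min (`|y| / A x) eps) + eta.

Definition solution (lam eta : R) (u w : R -> R) : Prop :=
  (forall t : R, is_derive t 1 u (w t / A (u t))) /\
  (forall t : R, is_derive t 1 w (u t - source lam eta t (u t) (w t))).

Let eps_gt0 : 0 < eps. Proof. by case/andP: eps01. Qed.
Let eps_le1 : eps <= 1. Proof. by case/andP: eps01. Qed.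
Let gamma_gt0 : 0 < gamma. Proof. by case/andP: gamma01. Qed.
Let gamma_lt1 : gamma < 1. Proof. by case/andP: gamma01. Qed.
Let A_gt0 x : 0 < A x. Proof. exact: lt_le_trans (A_ge x). Qed.
Let q1 : 0 < q - 1. Proof. by case/andP: q12 => *; rewrite subr_gt0. Qed.
Let q2 : 0 < 2 - q. Proof. by case/andP: q12 => *; rewrite subr_gt0. Qed.
Let p1 : 0 < p - 1.
Proof. by rewrite subr_gt0 (lt_trans _ p2) // ltr1n. Qed.

Lemma clamp_ge0 x : 0 <= clamp x.
Proof. by rewrite le_min le_max lexx orbT /= (ltW eps_gt0). Qed.

Lemma clamp_le_eps x : clamp x <= eps.
Proof. by rewrite ge_min lexx orbT. Qed.

Lemma clamp_le x : 0 <= x -> clamp x <= x.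
Proof. by move=> x0; rewrite ge_min ge_max lexx x0. Qed.

Lemma clamp_id x : 0 <= x <= eps -> clamp x = x.
Proof. by move=> /andP[x0 xe]; rewrite /clamp (max_l x0) (min_l xe). Qed.

Lemma slope_bounds (x y : R) :
  0 <= Num.min (`|y| / A x) eps <= eps /\ Num.min (`|y| / A x) eps <= `|y / A x|.
Proof.
rewrite le_min ge_min lexx orbT (divr_ge0 (normr_ge0 _) (ltW (A_gt0 _))).
rewrite (ltW eps_gt0); split => //.
by rewrite ge_min normrM normfV (gtr0_norm (A_gt0 x)) lexx.
Qed.

Lemma source_ge lam eta t x y : 0 <= lam ->
  lam * a t * clamp x `^ (q - 1) + eta <= source lam eta t x y.
Proof.
move=> l0; have [/eps_g/andP[g0 _] _] := slope_bounds x y.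
have := powR_ge0 (clamp x) (p - 1); rewrite /source; lra.
Qed.

Lemma source_ge0 lam eta t x y : 0 <= lam -> 0 <= eta ->
  0 <= source lam eta t x y.
Proof.
move=> l0 e0; apply: le_trans (source_ge _ _ _ _ l0).
by rewrite addr_ge0 // !mulr_ge0 ?powR_ge0 // ltW.
Qed.

Lemma source_le_slope lam eta t x y : 0 <= x ->
  source lam eta t x y <= lam * a t * clamp x `^ (q - 1) + x / 8 +
    gamma / 4 * `|y / A x| + eta.
Proof.
move=> x0; have [/eps_g/andP[_ g1] g2] := slope_bounds x y.
have : gamma / 4 * Num.min (`|y| / A x) eps <= gamma / 4 * `|y / A x|.
  by rewrite ler_wpM2l // divr_ge0 // ltW.
have : clamp x `^ (p - 1) <= x / 8.
  have -> : p - 1 = (p - 2) + 1 by ring.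
  have p20 : 0 < p - 2 by rewrite subr_gt0.
  rewrite powRD; last by rewrite gt_eqF // addr_gt0.
  rewrite powRr1 ?clamp_ge0 // mulrC ler_pM ?clamp_ge0 ?powR_ge0 ?clamp_le //.
  rewrite -div1r; apply: le_trans eps_p.
  by apply: ge0_ler_powR; rewrite ?nnegrE ?clamp_ge0 ?clamp_le_eps ?(ltW p20) // ltW.
rewrite /source; lra.
Qed.

Lemma source_continuous lam eta :
  continuous (fun z : R * R * R => source lam eta z.1.1 z.1.2 z.2).
Proof.
have c11 : continuous (fun z : R * R * R => z.1.1).
  move=> z; apply: (@continuous_comp _ _ _ fst fst); exact: cvg_fst.
have c12 : continuous (fun z : R * R * R => z.1.2).
  move=> z; apply: (@continuous_comp _ _ _ fst snd); [exact: cvg_fst|exact: cvg_snd].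
have c2 : continuous (fun z : R * R * R => z.2) by move=> z; exact: cvg_snd.
have cmin (f : R * R * R -> R) : continuous f -> continuous (fun z => Num.min (f z) eps).
  by move=> cf z; apply: (@continuous_min R _ f (fun=> eps)); [exact: cf|exact: cst_continuous].
have cclamp : continuous (fun z : R * R * R => clamp z.1.2).
  apply: cmin => z; apply: (@continuous_max R _ (fun z : R * R * R => z.1.2) (fun=> 0)); [exact: c12|exact: cst_continuous].
have cpow (b : R) : 0 < b -> continuous (fun z : R * R * R => clamp z.1.2 `^ b).
  move=> b0 z.
  have -> : (fun z : R * R * R => clamp z.1.2 `^ b) =
            (fun x => Num.max x 0 `^ b) \o (fun z : R * R * R => clamp z.1.2).
    by apply/funext => z' /=; rewrite (max_l (clamp_ge0 _)).
  by apply: continuous_comp; [exact: cclamp|exact: powR_pos_continuous].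
move=> z; apply: cvgD; last exact: cvg_cst.
apply: cvgD; first apply: cvgD.
- apply: cvgM; last exact: cpow.
  apply: cvgM; first exact: cvg_cst.
  by apply: (@continuous_comp _ _ _ (fun z : R * R * R => z.1.1)); [exact: c11|exact: a_cont].
- exact: cpow.
- apply: (@continuous_comp _ _ _ (fun z : R * R * R => Num.min (`|z.2| / A z.1.2) eps) g);
    last exact: g_cont.
  apply: cmin => {}z; apply: cvgM.
    by apply: cvg_norm; exact: c2.
  apply: cvgV; first by rewrite gt_eqF.
  by apply: (@continuous_comp _ _ _ (fun z : R * R * R => z.1.2)); [exact: c12|exact: A_cont].
Qed.

Lemma source_even lam eta t x y :
  source lam eta (- t) x (- y) = source lam eta t x y.
Proof. by rewrite /source a_even normrN. Qed.

Lemma source_bounded (lam S : R) : 0 <= lam ->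
  exists B, forall t x y : R, 0 <= t <= S -> source lam 0 t x y <= B.
Proof.
move=> l0; have [S0|S0] := ltP S 0.
  exists 0 => t x y /andP[t0 tS].
  by have := le_lt_trans (le_trans t0 tS) S0; rewrite ltxx.
have [|c _ Hc] := @EVT_max R a 0 S S0; first exact: continuous_subspaceT.
exists (lam * a c + 1 + gamma / 4) => t x y tS.
have clamp1 (b : R) : 0 < b -> clamp x `^ b <= 1.
  move=> b0; have -> : 1 = 1 `^ b :> R by rewrite powR1.
  apply: ge0_ler_powR; rewrite ?nnegrE ?clamp_ge0 ?(ltW b0) //.
  exact: le_trans (clamp_le_eps x) eps_le1.
have [/[dup] gr /eps_g/andP[_ g1] _] := slope_bounds x y.
have : gamma / 4 * Num.min (`|y| / A x) eps <= gamma / 4 * 1.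
  rewrite ler_wpM2l ?divr_ge0 ?(ltW gamma_gt0) //.
  by case/andP: gr => _ /le_trans; apply.
have : clamp x `^ (p - 1) <= 1 by exact: clamp1.
have : lam * a t * clamp x `^ (q - 1) <= lam * a c * 1.
  rewrite ler_pM ?(mulr_ge0 l0) ?powR_ge0 ?clamp1 ?(ltW (a_pos _)) //.
  by rewrite ler_wpM2l // Hc // in_itv.
rewrite /source; lra.
Qed.

(** [u'] may vanish at [t0]; the strict sign of [w'] makes [u] drop anyway. *)
Lemma solution_drop lam eta u w (t0 : R) :
  solution lam eta u w -> w t0 <= 0 ->
  u t0 < source lam eta t0 (u t0) (w t0) ->
  exists2 del, 0 < del & forall t, t0 < t < t0 + del -> u t < u t0.
Proof.
move=> [du dw] w0 us.
have [|del del0 Hdel] := is_derive_lt0_right (dw t0); first by rewrite subr_lt0.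
exists del => // t /andP[t0t tdel].
apply: (is_derive_lt0_decr t0t (fun s _ => du s)) => s /andP[t0s st].
by rewrite pmulr_llt0 ?invr_gt0 // (lt_le_trans (Hdel s t0s _)) // (lt_trans st).
Qed.

(** At a negative minimum [w = 0], and [w' = u - source < 0] because the source
    is nonnegative, so [u] would decrease further. *)
Lemma solution_ge0 lam eta u w T : 0 <= lam -> 0 <= eta -> 0 < T ->
  solution lam eta u w -> w 0 = 0 -> u T = 0 -> forall t : R, 0 <= t <= T -> 0 <= u t.
Proof.
move=> l0 e0 T0 /[dup] sol [du dw] w0 uT.
have cu : continuous u by move=> t; exact: is_derive_continuous (du t).
have [|m] := @EVT_min R u 0 T (ltW T0); first exact: continuous_subspaceT.
rewrite in_itv /= => /andP[m0 mT] Hm t tT.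
apply: le_trans (Hm t _); last by rewrite in_itv.
rewrite leNgt; apply/negP => um.
have {}mT : m < T.
  by rewrite lt_neqAle mT andbT; apply/eqP => E; move: um; rewrite E uT ltxx.
have wm : w m = 0.
  move: m0; rewrite le_eqVlt => /predU1P[<- //|m0].
  have m0T : 0 < m < T by rewrite m0.
  have Hm' s : 0 < s < T -> u m <= u s.
    by move=> /andP[s0 sT]; apply: Hm; rewrite in_itv /= !ltW.
  have /eqP := @is_derive_min R u (fun t => w t / A (u t)) 0 T m du m0T Hm'.
  by rewrite mulf_eq0 invr_eq0 (gt_eqF (A_gt0 _)) orbF => /eqP.
have [||del del0 Hd] := solution_drop (t0 := m) sol; first by rewrite wm.
  exact: lt_le_trans um (source_ge0 _ _ _ l0 e0).
pose s := m + Num.min (del / 2) (T - m).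
have q0 : 0 < Num.min (del / 2) (T - m) by rewrite lt_min divr_gt0 // subr_gt0.
have q3 : Num.min (del / 2) (T - m) <= del / 2 by rewrite ge_min lexx.
have q4 : Num.min (del / 2) (T - m) <= T - m by rewrite ge_min lexx orbT.
have us : u s < u m by apply: Hd; rewrite /s; apply/andP; split; lra.
have /Hm : s \in `[0, T] by rewrite in_itv /= /s; apply/andP; split; lra.
by rewrite leNgt us.
Qed.

(** The pointwise form of the energy identity obtained by testing the equation
    with [u]; [C] is a constant of [young_sublinear]. *)
Lemma energy_density C lam eta t x y :
  (forall x y : R, 0 <= x -> 0 <= y ->
    (x * y `^ (q - 1)) ^+ 2 <= y ^+ 2 / 64 + C * x `^ r) ->
  0 <= lam -> 0 <= eta -> 0 <= x ->
  let s := y / A x in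
  let f := source lam eta t x y in
  let n := 4 * C * lam `^ r * a t `^ r + 2 * eta ^+ 2 in
  gamma / 2 * (x ^+ 2 + s ^+ 2) <= (x - f) * x + s * y + n /\
  (x <= 1 -> `|2 * y * (x - f)| <= (A 1 ^+ 2 + 6) * (x ^+ 2 + s ^+ 2) + 2 * n).
Proof.
move=> HC l0 e0 x0 s f n.
have la0 : 0 <= lam * a t by rewrite mulr_ge0 // ltW.
pose z := lam * a t * clamp x `^ (q - 1).
have z0 : 0 <= z by rewrite mulr_ge0 // powR_ge0.
have z2 : z ^+ 2 <= x ^+ 2 / 64 + C * lam `^ r * a t `^ r.
  rewrite -[C * _ * _]mulrA -powRM ?(ltW (a_pos _)) //.
  apply: le_trans (HC _ _ la0 (clamp_ge0 x)) _.
  by rewrite lerD2r ler_pM2r ?invr_gt0 // ler_sqr ?nnegrE ?clamp_ge0 // clamp_le.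
have f0 : 0 <= f by exact: source_ge0.
have f1 : f <= z + x / 8 + gamma / 4 * `|s| + eta by exact: source_le_slope.
have ys : y = A x * s by rewrite /s mulrC divfK // gt_eqF.
clearbody s.
have s2 : `|s| ^+ 2 = s ^+ 2 by rewrite real_normK // num_real.
have sn0 : 0 <= `|s| by [].
have sy : gamma * s ^+ 2 <= s * y.
  have -> : s * y = A x * s ^+ 2 by rewrite ys; ring.
  by rewrite ler_wpM2r ?sqr_ge0.
set P := C * lam `^ r * a t `^ r in z2.
have nP : n = 4 * P + 2 * eta ^+ 2 by rewrite /n /P !mulrA.
split.
  have fx : f * x <= z * x + x ^+ 2 / 8 + gamma / 4 * `|s| * x + eta * x.
    have -> : z * x + x ^+ 2 / 8 + gamma / 4 * `|s| * x + eta * x =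
      (z + x / 8 + gamma / 4 * `|s| + eta) * x by ring.
    by rewrite ler_wpM2r.
  have zx : z * x <= 4 * z ^+ 2 + x ^+ 2 / 16.
    by have := sqr_ge0 (2 * z - x / 4); lra.
  have gx : gamma / 4 * `|s| * x <= gamma / 8 * (s ^+ 2 + x ^+ 2).
    have : 0 <= gamma / 8 * (`|s| - x) ^+ 2 by rewrite mulr_ge0 ?sqr_ge0 ?divr_ge0 ?ltW.
    by rewrite -s2; move: (`|s|) => v; lra.
  have ex : eta * x <= x ^+ 2 / 8 + 2 * eta ^+ 2.
    by have := sqr_ge0 (x - 4 * eta); lra.
  have gx2 : gamma * x ^+ 2 <= x ^+ 2 by rewrite ler_piMl ?sqr_ge0 ?ltW.
  have gs2 : 0 <= gamma * s ^+ 2 by rewrite mulr_ge0 ?sqr_ge0 ?ltW.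
  have -> : (x - f) * x = x ^+ 2 - f * x by ring.
  rewrite nP; move: fx zx gx ex gx2 gs2 sy z2.
  have := sqr_ge0 x.
  set X := x ^+ 2; set S := s ^+ 2; set Z := z ^+ 2; set N := eta ^+ 2.
  by rewrite -/X => *; lra.
move=> x1.
have y2 : y ^+ 2 <= A 1 ^+ 2 * s ^+ 2.
  by rewrite ys exprMn ler_wpM2r ?sqr_ge0 // ler_sqr ?nnegrE ?(ltW (A_gt0 _)) // A_mono.
have d1 : `|2 * y * (x - f)| <= y ^+ 2 + (x - f) ^+ 2.
  have := sqr_ge0 (y - (x - f)); have := sqr_ge0 (y + (x - f)).
  by move=> *; apply/ler_normlP; split; lra.
have d2 : (x - f) ^+ 2 <= (x + f) ^+ 2.
  have : 0 <= x * f by rewrite mulr_ge0.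
  by move=> *; lra.
pose b := z + 9 / 8 * x + `|s| / 4 + eta.
have d3 : (x + f) ^+ 2 <= b ^+ 2.
  have gs : gamma / 4 * `|s| <= `|s| / 4.
    have : gamma * `|s| <= `|s| by rewrite ler_piMl // ltW.
    by lra.
  have xfb : x + f <= b by rewrite /b; move: f1 gs; lra.
  have xf0 : 0 <= x + f by rewrite addr_ge0.
  by rewrite ler_sqr ?nnegrE // (le_trans xf0).
have d4 : b ^+ 2 <= 4 * (z ^+ 2 + (9 / 8 * x) ^+ 2 + (`|s| / 4) ^+ 2 + eta ^+ 2).
  rewrite /b; move: (9 / 8 * x) (`|s| / 4) => k l.
  have := sqr_ge0 (z - k); have := sqr_ge0 (z - l); have := sqr_ge0 (z - eta).
  have := sqr_ge0 (k - l); have := sqr_ge0 (k - eta); have := sqr_ge0 (l - eta).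
  by move=> *; lra.
apply: (le_trans d1); rewrite nP.
have A10 : 0 <= A 1 ^+ 2 * x ^+ 2 by rewrite mulr_ge0 ?sqr_ge0.
have P0 : 0 <= P.
  have := HC _ 0 la0 (lexx _).
  rewrite powR0 ?gt_eqF // mulr0 expr0n /= mul0r add0r.
  by rewrite powRM ?(ltW (a_pos _)) // mulrA.
have s2' : (`|s| / 4) ^+ 2 = s ^+ 2 / 16.
  by rewrite expr_div_n s2; congr (_ / _); rewrite -natrX.
have x2' : (9 / 8 * x) ^+ 2 = 81 / 64 * x ^+ 2 by field.
rewrite s2' x2' in d4.
have -> : (A 1 ^+ 2 + 6) * (x ^+ 2 + s ^+ 2) =
  A 1 ^+ 2 * x ^+ 2 + A 1 ^+ 2 * s ^+ 2 + 6 * x ^+ 2 + 6 * s ^+ 2 by ring.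
move: d4 d3 d2 y2 z2 A10 P0 (sqr_ge0 s) (sqr_ge0 x).
set B2 := b ^+ 2; set X := x ^+ 2; set S := s ^+ 2; set Z := z ^+ 2.
set N := eta ^+ 2; set Y := y ^+ 2; set V := (x - f) ^+ 2; set W := (x + f) ^+ 2.
set K := A 1 ^+ 2 * X; set L := A 1 ^+ 2 * S.
clearbody B2 X S Z N Y V W K L P => *; lra.
Qed.

Context (C M : R) (Q : R -> R).
Hypotheses (C_ge0 : 0 <= C) (M_ge0 : 0 <= M)
  (C_young : forall x y : R, 0 <= x -> 0 <= y ->
    (x * y `^ (q - 1)) ^+ 2 <= y ^+ 2 / 64 + C * x `^ r).
Hypotheses (Q_derive : forall t : R, is_derive t 1 Q (a t `^ r))
  (Q_bound : forall t, 0 <= Q t <= M).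

(** A primitive of the error term of [energy_density]. *)
Definition load (lam eta t : R) : R := 4 * C * lam `^ r * Q t + 2 * eta ^+ 2 * t.

Definition energy (lam eta : R) (u w : R -> R) (t : R) : R :=
  w t * u t + load lam eta t.

Definition energy_const : R := (2 * (A 1 ^+ 2 + 6) / gamma + 2) * (4 * C * M + 2).

Let slopes_const := A 1 ^+ 2 + 6.

Let slopes_const_ge : 1 <= slopes_const.
Proof. by have := sqr_ge0 (A 1); rewrite /slopes_const; lra. Qed.

Let load_density lam eta t := 4 * C * lam `^ r * a t `^ r + 2 * eta ^+ 2.

Let load_density_ge0 lam eta t : 0 <= load_density lam eta t.
Proof.
rewrite addr_ge0 //; last by rewrite mulr_ge0 ?sqr_ge0.
by rewrite mulr_ge0 ?powR_ge0 // mulr_ge0 ?powR_ge0 // mulr_ge0.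
Qed.

Let load_derive lam eta (t : R) :
  is_derive t 1 (load lam eta) (load_density lam eta t).
Proof.
have := is_derive_add (is_derive_scale (4 * C * lam `^ r) (Q_derive t))
  (is_derive_scale (2 * eta ^+ 2) (is_derive_id t 1)).
by rewrite mulr1.
Qed.

Lemma load_mono lam eta s t : s <= t -> load lam eta s <= load lam eta t.
Proof.
move=> st; apply: (is_derive_ge0 st (fun x _ => load_derive lam eta x)).
by move=> *; exact: load_density_ge0.
Qed.

Let energy_derive lam eta u w (t : R) : solution lam eta u w ->
  is_derive t 1 (energy lam eta u w)
    ((u t - source lam eta t (u t) (w t)) * u t + w t / A (u t) * w t +
     load_density lam eta t).
Proof.
move=> [du dw]; have := is_derive_add (is_derive_mul (dw t) (du t)) (load_derive lam eta t).
by rewrite [w t * _]mulrC.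
Qed.

Lemma energy_growth lam eta u w s t m : 0 <= lam -> 0 <= eta ->
  solution lam eta u w -> s <= t -> (forall x, s <= x <= t -> 0 <= u x) ->
  (forall x, s <= x <= t -> m <= u x ^+ 2) ->
  gamma / 2 * m * (t - s) <= energy lam eta u w t - energy lam eta u w s.
Proof.
move=> l0 e0 sol st u0 um.
rewrite mulrBr.
apply: (@is_derive_le R (fun x => gamma / 2 * m * x) (energy lam eta u w)
  (fun=> gamma / 2 * m) _ s t st _ (fun x _ => energy_derive x sol)).
  move=> x _; rewrite -[X in is_derive _ _ _ X]mulr1.
  exact: is_derive_scale (is_derive_id x 1).
move=> x xst; have [+ _] := energy_density x (w x) C_young l0 e0 (u0 x xst).
apply: le_trans.
by rewrite ler_wpM2l ?ler_wpDr ?sqr_ge0 ?um // divr_ge0 // ltW.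
Qed.

(** With [s = w / A u], the derivative [2 * u * s] of [u ^+ 2] is at most
    [u ^+ 2 + s ^+ 2], which the density of the energy controls; thus pointwise
    bounds are obtained without integrals. *)
Lemma energy_control_u lam eta u w s t : 0 <= lam -> 0 <= eta ->
  solution lam eta u w -> s <= t -> (forall x, s <= x <= t -> 0 <= u x) ->
  `|u t ^+ 2 - u s ^+ 2| <= 2 / gamma * (energy lam eta u w t - energy lam eta u w s).
Proof.
move=> l0 e0 sol st u0; have [du dw] := sol.
rewrite !expr2 mulrBr.
apply: (@is_derive_norm_le R (fun x => u x * u x)
  (fun x => 2 / gamma * energy lam eta u w x)
  (fun x => w x / A (u x) * u x + u x * (w x / A (u x))) _ s t st
  (fun x _ => is_derive_mul (du x) (du x))
  (fun x _ => is_derive_scale (2 / gamma) (energy_derive x sol))).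
move=> x xst; have [+ _] := energy_density x (w x) C_young l0 e0 (u0 x xst).
set S := w x / A (u x); set E := (_ - _) * _ + _ + _; rewrite -/E => HE.
have : u x ^+ 2 + S ^+ 2 <= 2 / gamma * E.
  rewrite -ler_pdivrMl ?divr_gt0 // invf_div; exact: HE.
apply: le_trans; have := sqr_ge0 (u x - S); have := sqr_ge0 (u x + S).
by move=> *; apply/ler_normlP; split; lra.
Qed.

Lemma energy_control_w lam eta u w s t : 0 <= lam -> 0 <= eta ->
  solution lam eta u w -> s <= t -> (forall x, s <= x <= t -> 0 <= u x <= 1) ->
  `|w t ^+ 2 - w s ^+ 2| <=
    2 * slopes_const / gamma * (energy lam eta u w t - energy lam eta u w s) +
    2 * (load lam eta t - load lam eta s).
Proof.
move=> l0 e0 sol st u0; have [du dw] := sol.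
have -> : 2 * slopes_const / gamma * (energy lam eta u w t - energy lam eta u w s) +
    2 * (load lam eta t - load lam eta s) =
  (2 * slopes_const / gamma * energy lam eta u w t + 2 * load lam eta t) -
  (2 * slopes_const / gamma * energy lam eta u w s + 2 * load lam eta s) by ring.
rewrite !expr2.
apply: (@is_derive_norm_le R (fun x => w x * w x)
  (fun x => 2 * slopes_const / gamma * energy lam eta u w x + 2 * load lam eta x)
  (fun x => (u x - source lam eta x (u x) (w x)) * w x +
            w x * (u x - source lam eta x (u x) (w x))) _ s t st
  (fun x _ => is_derive_mul (dw x) (dw x))
  (fun x _ => is_derive_add
    (is_derive_scale (2 * slopes_const / gamma) (energy_derive x sol))
    (is_derive_scale 2 (load_derive lam eta x)))).
move=> x xst; have /andP[ux0 ux1] := u0 x xst.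
have [+ /(_ ux1)] := energy_density x (w x) C_young l0 e0 ux0.
set S := w x / A (u x); rewrite -/(load_density lam eta x).
set E := (_ - _) * _ + _ + _ => HE Hw.
have HE' : u x ^+ 2 + S ^+ 2 <= 2 / gamma * E.
  rewrite -ler_pdivrMl ?divr_gt0 // invf_div; exact: HE.
have : slopes_const * (u x ^+ 2 + S ^+ 2) <= slopes_const * (2 / gamma * E).
  by rewrite ler_wpM2l // (le_trans ler01).
have -> : slopes_const * (2 / gamma * E) = 2 * slopes_const / gamma * E by ring.
move: Hw; rewrite -/slopes_const -mulrA.
set V := w x * _.
have -> : (u x - source lam eta x (u x) (w x)) * w x +
  w x * (u x - source lam eta x (u x) (w x)) = 2 * V.
  by rewrite /V; ring.
by move=> *; lra.
Qed.

(** The energy is balanced between the ends of the interval, so its total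
    increment is that of [load], which is of order [lam `^ r] uniformly in
    the length [T]. *)
Lemma bvp_bound lam eta u w T : 0 <= lam -> 0 <= eta -> 0 < T ->
  solution lam eta u w -> w 0 = 0 -> u T = 0 ->
  eta ^+ 2 * T <= lam `^ r -> energy_const * lam `^ r <= 1 ->
  forall t : R, 0 <= t <= T ->
  u t ^+ 2 <= energy_const * lam `^ r /\ w t ^+ 2 <= energy_const * lam `^ r.
Proof.
move=> l0 e0 T0 sol w0 uT eT small.
have u0 := solution_ge0 l0 e0 T0 sol w0 uT.
pose L := lam `^ r; have L0 : 0 <= L := powR_ge0 _ _.
have loadT : load lam eta T - load lam eta 0 <= (4 * C * M + 2) * L.
  have /andP[Q0 _] := Q_bound 0; have /andP[_ QT] := Q_bound T.
  rewrite /load -/L.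
  have : 4 * C * L * (Q T - Q 0) <= 4 * C * L * M.
    by rewrite ler_wpM2l ?mulr_ge0 // lerBlDl ler_wpDl.
  by rewrite -/L in eT; lra.
have enT : energy lam eta u w T - energy lam eta u w 0 <= (4 * C * M + 2) * L.
  by rewrite /energy uT w0 mulr0 mul0r !add0r.
have mono s t : 0 <= s -> s <= t -> t <= T ->
    energy lam eta u w s <= energy lam eta u w t.
  move=> s0 st tT; rewrite -subr_ge0.
  have := @energy_growth lam eta u w s t 0 l0 e0 sol st; rewrite mulr0 mul0r; apply.
    by move=> x /andP[sx xt]; apply: u0; rewrite (le_trans s0 sx) (le_trans xt).
  by move=> *; exact: sqr_ge0.
have D0 : 0 <= (4 * C * M + 2) * L by rewrite mulr_ge0 // addr_ge0 // !mulr_ge0.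
have cg : 2 / gamma <= 2 * (A 1 ^+ 2 + 6) / gamma.
  by rewrite ler_pM2r ?invr_gt0 // ler_pMr // slopes_const_ge.
have cg0 : 0 <= 2 / gamma by rewrite divr_ge0 // ltW.
have bu t : 0 <= t <= T -> u t ^+ 2 <= energy_const * L.
  move=> /andP[t0 tT].
  have ut x : t <= x <= T -> 0 <= u x.
    by move=> /andP[tx xT]; apply: u0; rewrite (le_trans t0 tx) xT.
  have := energy_control_u l0 e0 sol tT ut; rewrite uT expr0n /= sub0r normrN.
  rewrite ger0_norm ?sqr_ge0 // => /le_trans; apply.
  rewrite /energy_const -[leRHS]mulrA.
  have := mono _ _ (lexx 0) t0 tT => m0.
  apply: ler_pM => //.
  - by rewrite subr_ge0 mono.
  - by apply: le_trans cg _; rewrite lerDl.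
  - by apply: le_trans enT; rewrite lerD2l lerN2.
move=> t /[dup] tT /andP[t0 leT]; split; first exact: bu.
have u01 x : 0 <= x <= t -> 0 <= u x <= 1.
  move=> /andP[x0 xt]; have xT : 0 <= x <= T by rewrite x0 (le_trans xt).
  rewrite u0 //= -(@ler_sqr _ (u x)) ?nnegrE ?u0 // expr1n.
  by rewrite (le_trans (bu x xT)).
have := energy_control_w l0 e0 sol t0 u01; rewrite w0 expr0n /= subr0.
rewrite ger0_norm ?sqr_ge0 // => /le_trans; apply.
have k0 : 0 <= 2 * slopes_const / gamma := le_trans cg0 cg.
rewrite /energy_const -[leRHS]mulrA [leRHS]mulrDl lerD //.
  rewrite -/slopes_const ler_wpM2l //; apply: le_trans enT.
  by rewrite lerD2r mono.
by rewrite ler_wpM2l // (le_trans _ loadT) // lerD2r load_mono.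
Qed.

(** The energy is bounded and nondecreasing, hence nearly constant beyond some
    time; then so is [u ^+ 2], and it cannot stay away from [0] because the
    energy would grow linearly. *)
Lemma solution_decay lam u w : 0 <= lam -> solution lam 0 u w ->
  (forall t : R, 0 <= t -> 0 <= u t <= 1 /\ `|w t| <= 1) ->
  forall e : R, 0 < e ->
  exists2 T, 0 <= T & forall t, T <= t -> u t < e.
Proof.
move=> l0 sol uw e e0; pose E := energy lam 0 u w.
have u0 s t x : 0 <= s -> s <= x <= t -> 0 <= u x.
  by move=> s0 /andP[sx _]; have [] := uw x (le_trans s0 sx) => /andP[].
have mono s t : 0 <= s -> s <= t -> E s <= E t.
  move=> s0 st; rewrite -subr_ge0.
  have := @energy_growth lam 0 u w s t 0 l0 (lexx 0) sol st; rewrite mulr0 mul0r; apply.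
    by move=> x; exact: u0.
  by move=> *; exact: sqr_ge0.
have supE : has_sup (E @` [set t | 0 <= t]).
  split; first by exists (E 0); exists 0 => //=.
  exists (1 + 4 * C * lam `^ r * M) => _ [t /= t0 <-].
  have [/andP[ut0 ut1] wt] := uw t t0.
  rewrite /E /energy /load expr0n /= mulr0 mul0r addr0 lerD //.
    rewrite (le_trans (ler_norm _)) // normrM -[leRHS]mulr1 ler_pM //.
    by rewrite ger0_norm.
  by rewrite ler_wpM2l ?mulr_ge0 ?powR_ge0 //; case/andP: (Q_bound t).
pose del := gamma * e ^+ 2 / 4.
have del0 : 0 < del by rewrite divr_gt0 // mulr_gt0 // exprn_gt0.
have [_ [T /= T0 <-] HT] := sup_adherent del0 supE.
have near_sup t : T <= t -> E t - E T <= del.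
  move=> Tt; have : E t <= sup (E @` [set t | 0 <= t]).
    by apply: ub_le_sup; [case: supE|exists t => //=; exact: le_trans Tt].
  by lra.
exists T => // t Tt; rewrite ltNge; apply/negP => et.
have gd : 2 / gamma * del = e ^+ 2 / 2 by rewrite /del; field; rewrite gt_eqF.
have et2 : e ^+ 2 <= u t ^+ 2.
  by rewrite ler_sqr ?nnegrE ?(ltW e0) // (le_trans (ltW e0)).
have big s : T <= s -> e ^+ 2 / 2 <= u s ^+ 2.
  move=> Ts.
  have H x y : T <= x -> x <= y -> `|u y ^+ 2 - u x ^+ 2| <= e ^+ 2 / 2.
    move=> Tx xy; have x0 := le_trans T0 Tx.
    apply: le_trans (energy_control_u l0 (lexx 0) sol xy _) _.
      by move=> z; exact: u0.
    rewrite -gd ler_wpM2l ?divr_ge0 ?(ltW gamma_gt0) //.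
    apply: le_trans (near_sup _ (le_trans Tx xy)).
    by rewrite lerD2l lerN2 mono.
  have [st|/ltW ts] := leP s t.
    by have /ler_normlP[_] := H s t Ts st; lra.
  by have /ler_normlP[] := H t s Tt ts; lra.
have T2 : T <= T + 2 by rewrite lerDl.
have := @energy_growth lam 0 u w T (T + 2) (e ^+ 2 / 2) l0 (lexx 0) sol T2.
rewrite addrAC subrr add0r => H.
have : gamma / 2 * (e ^+ 2 / 2) * 2 <= E (T + 2) - E T.
  apply: H => x; first exact: u0.
  by move=> /andP[Tx _]; exact: big.
have := near_sup _ T2.
have -> : gamma / 2 * (e ^+ 2 / 2) * 2 = 2 * del by rewrite /del; field.
lra.
Qed.

(** Since [q - 1 < 1], the concave term beats any linear one near [0], and [a]
    is bounded below on compact intervals. *)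
Lemma source_superlinear (lam k S : R) : 0 < lam -> 0 < k -> 0 <= S ->
  exists2 al, 0 < al <= eps & forall eta t x y, 0 <= t <= S -> 0 <= x <= al ->
    k * x + eta <= source lam eta t x y.
Proof.
move=> l0 k0 S0.
have [|m _ Hm] := @EVT_min R a 0 S S0; first exact: continuous_subspaceT.
pose c := lam * a m / k; have c0 : 0 < c by rewrite divr_gt0 // mulr_gt0.
exists (Num.min eps (c `^ (2 - q)^-1)).
  by rewrite lt_min eps_gt0 powR_gt0 // ge_min lexx.
move=> eta t x y tS; rewrite le_min => /and3P[x0 xe xc].
apply: le_trans (source_ge _ _ _ _ (ltW l0)); rewrite lerD2r.
rewrite clamp_id ?x0 //.
have -> : k * x = k * x `^ (2 - q) * x `^ (q - 1).
  have s1 : 2 - q + (q - 1) = 1 by ring.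
  by rewrite -mulrA -powRD s1 ?powRr1 // oner_eq0.
rewrite ler_wpM2r ?powR_ge0 //; apply: (@le_trans _ _ (k * c)).
  rewrite ler_pM2l //.
  have -> : c = (c `^ (2 - q)^-1) `^ (2 - q).
    by rewrite -powRrM mulVf ?gt_eqF // powRr1 // ltW.
  by apply: ge0_ler_powR; rewrite ?nnegrE ?powR_ge0 // ltW.
rewrite /c mulrC divfK ?gt_eqF // ler_pM2l // Hm // in_itv //=.
Qed.

(** If [u] starts too low, the concave term bends it down so fast that it
    becomes negative before time [1]; this keeps the solutions away from [0]
    uniformly in [T] and [eta]. *)
Lemma initial_value_lb (lam : R) : 0 < lam ->
  exists2 al, 0 < al & forall eta u w T, 0 < eta -> 1 <= T ->
    solution lam eta u w -> w 0 = 0 -> u T = 0 -> al <= u 0.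
Proof.
move=> l0; pose k := 2 + 4 * A 1; have A1 := A_gt0 1.
have k0 : 0 < k by rewrite /k; lra.
have [al /andP[al0 ale] Hal] := source_superlinear l0 k0 ler01.
exists al => // eta u w T e0 T1 sol w0 uT; have [du dw] := sol.
(* While [u <= al] one has [w' <= - (k - 1) * u - eta]: [u] decreases, and the
   value of [k] makes the slope accumulated on [0, 1 / 2] large enough to take
   [u] below 0 during [1 / 2, 1]. *)
rewrite leNgt; apply/negP => u0al.
have T0 : 0 < T by apply: lt_le_trans T1.
have u0 t : 0 <= t <= 1 -> 0 <= u t.
  move=> /andP[t0 t1]; apply: (solution_ge0 (ltW l0) (ltW e0) T0 sol w0 uT).
  by rewrite t0 (le_trans t1).
have dw_le t : 0 <= t <= 1 -> u t <= al ->
    u t - source lam eta t (u t) (w t) <= - ((k - 1) * u t + eta).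
  move=> t01 ut; have : k * u t + eta <= source lam eta t (u t) (w t).
    by apply: Hal => //; rewrite u0.
  by lra.
have dw_lt0 t : 0 <= t <= 1 -> u t <= al ->
    u t - source lam eta t (u t) (w t) < 0.
  move=> t01 ut; apply: le_lt_trans (dw_le t t01 ut) _.
  by have : 0 <= (k - 1) * u t; [rewrite mulr_ge0 ?u0 // /k; lra|lra].
have w_lt0 s : 0 < s <= 1 -> (forall x, 0 <= x < s -> u x <= al) -> w s < 0.
  move=> /andP[s0 s1] H; rewrite -w0.
  apply: (is_derive_lt0_decr s0 (fun x _ => dw x)) => x /andP[x0 xs].
  apply: dw_lt0; first by rewrite (ltW x0) (le_trans (ltW xs)).
  by apply: H; rewrite (ltW x0).
have ual t : 0 <= t <= 1 -> u t <= al.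
  move=> /andP[t0 t1]; rewrite leNgt; apply/negP => /ltW alu.
  have cu : continuous u by move=> x; exact: is_derive_continuous (du x).
  have [tau [/andP[tau0 taut] utau Htau]] := first_crossing cu t0 u0al alu.
  have : u tau < u 0.
    apply: (is_derive_lt0_decr tau0 (fun x _ => du x)) => x /andP[x0 xtau].
    rewrite pmulr_llt0 ?invr_gt0 //; apply: w_lt0.
      by rewrite x0 (le_trans (ltW xtau)) // (le_trans taut).
    move=> z /andP[z0 zx]; apply: ltW; apply: Htau.
    by rewrite z0 (lt_trans zx).
  by rewrite utau ltNge (ltW u0al).
have w_le0 t : 0 <= t <= 1 -> w t <= 0.
  move=> /andP[]; rewrite le_eqVlt => /predU1P[<-|t0] t1; first by rewrite w0.
  apply: ltW; apply: w_lt0; first by rewrite t0.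
  by move=> x /andP[x0 xt]; apply: ual; rewrite x0 (le_trans (ltW xt)).
have k10 : 0 <= k - 1 by rewrite /k; lra.
pose h : R := 1 / 2; have h01 : 0 <= h <= 1 by rewrite /h; lra.
have /andP[h0 h1] := h01.
have u_mono s : 0 <= s <= h -> u h <= u s.
  move=> /andP[s0 sh]; rewrite -subr_le0.
  have := @is_derive_le_linear R u _ s h 0 sh (fun x _ => du x).
  rewrite mul0r; apply=> x /andP[sx xh].
  rewrite pmulr_lle0 ?invr_gt0 // w_le0 // (le_trans s0 sx) /=.
  by rewrite (le_trans xh).
have wh : w h - w 0 <= - ((k - 1) * u h + eta) * (h - 0).
  apply: (@is_derive_le_linear R w _ 0 h _ h0 (fun x _ => dw x)) => x /andP[x0 xh].
  have x01 : 0 <= x <= 1 by rewrite x0 (le_trans xh).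
  apply: le_trans (dw_le x x01 (ual x x01)) _.
  rewrite lerN2 lerD2r ler_wpM2l //; apply: u_mono.
  by rewrite x0.
have u1 : u 1 - u h <= w h / A 1 * (1 - h).
  apply: (@is_derive_le_linear R u _ h 1 _ h1 (fun x _ => du x)) => x /andP[hx x1].
  have x01 : 0 <= x <= 1 by rewrite (le_trans h0 hx).
  have wxh : w x <= w h.
    rewrite -subr_le0.
    have := @is_derive_le_linear R w _ h x 0 hx (fun x _ => dw x).
    rewrite mul0r; apply=> z /andP[hz zx].
    have z01 : 0 <= z <= 1 by rewrite (le_trans h0 hz) (le_trans zx).
    exact/ltW/dw_lt0/ual.
  apply: (@le_trans _ _ (w h / A (u x))); first by rewrite ler_pM2r ?invr_gt0.
  rewrite ler_wnM2l ?w_le0 // lef_pV2 ?posrE // A_mono //.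
  by rewrite (le_trans (ual x x01)) // (le_trans ale).
have := u0 1; rewrite lexx ler01 => /(_ isT) u10.
have uh0 := u0 h h01.
move: wh u1; rewrite w0 !subr0 => wh u1.
have hh : 1 - h = h by rewrite /h; field.
rewrite hh in u1.
have u1' : A 1 * (u 1 - u h) <= w h * h.
  rewrite -ler_pdivlMl // mulrA [_^-1 * _]mulrC; exact: u1.
have : A 1 * (u 1 - u h) <= - ((k - 1) * u h + eta) * h * h.
  by apply: le_trans u1' _; rewrite ler_wpM2r.
have : 0 <= A 1 * u 1 by rewrite mulr_ge0 // ltW.
by rewrite /k /h; lra.
Qed.

(** At a first zero [u] would vanish together with [w]; but the concave term
    makes [w] nonincreasing there, so that [u] could not have been larger
    before. *)
Lemma solution_gt0 lam u w : 0 < lam -> solution lam 0 u w ->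
  (forall t, 0 <= u t) -> 0 < u 0 -> forall t : R, 0 <= t -> 0 < u t.
Proof.
move=> l0 [du dw] u_ge0 u00 t t0; rewrite ltNge; apply/negP => ut.
have cu : continuous u by move=> x; exact: is_derive_continuous (du x).
have cNu : continuous (fun x => - u x) by move=> x; apply: cvgN; exact: cu.
have [||tau [/andP[tau0 _] /eqP utau Htau]] := first_crossing (al := 0) cNu t0.
- by rewrite oppr_lt0.
- by rewrite oppr_ge0.
rewrite oppr_eq0 in utau; move/eqP : utau => utau.
have wtau : w tau = 0.
  have tau_in : tau - 1 < tau < tau + 1 by rewrite ltrDl ltrBlDr ltrDl ltr01.
  have min_tau s : tau - 1 < s < tau + 1 -> u tau <= u s by rewrite utau.
  have /eqP := is_derive_min du tau_in min_tau.
  by rewrite mulf_eq0 invr_eq0 (gt_eqF (A_gt0 _)) orbF => /eqP.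
have [al /andP[al0 _] Hal] := source_superlinear l0 ltr01 (ltW tau0).
have /cvgrPdist_lt /(_ _ al0) [del /= del0 Hdel] := cu tau.
pose s := Num.max 0 (tau - del / 2).
have s0 : 0 <= s by rewrite le_max lexx.
have stau : s < tau by rewrite gt_max tau0 ltrBlDr ltrDl divr_gt0.
have sdel : tau - del / 2 <= s by rewrite le_max lexx orbT.
have dw_le0 x : s <= x <= tau -> u x - source lam 0 x (u x) (w x) <= 0.
  move=> /andP[sx xtau]; rewrite subr_le0.
  have := Hal 0 x (u x) (w x); rewrite mul1r addr0; apply.
    by rewrite (le_trans s0 sx).
  rewrite u_ge0 /=; have := Hdel x; rewrite /ball_ /= utau sub0r normrN => H.
  apply: le_trans (ler_norm _) _; apply/ltW/H.
  by rewrite ger0_norm ?subr_ge0 //; lra.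
have w_ge0 x : s <= x <= tau -> 0 <= w x.
  move=> /andP[sx xtau]; have := @is_derive_le_linear R w _ x tau 0 xtau (fun x _ => dw x).
  rewrite mul0r wtau sub0r oppr_le0; apply=> z /andP[xz ztau].
  by apply: dw_le0; rewrite (le_trans sx).
have : u s <= u tau.
  apply: (is_derive_ge0 (ltW stau) (fun x _ => du x)) => x xs.
  by rewrite divr_ge0 ?w_ge0 // ltW.
have := Htau s; rewrite s0 stau oppr_lt0 utau => /(_ isT).
by move=> us; rewrite leNgt us.
Qed.

Lemma source_eta lam eta t x y : source lam eta t x y = source lam 0 t x y + eta.
Proof. by rewrite /source addr0. Qed.

(** Letting the interval grow and [eta] shrink in the boundary value problems;
    [eta] is so small that its contribution to [load] stays below
    [lam `^ r]. *)
Lemma entire_solution lam : 0 < lam -> energy_const * lam `^ r <= 1 ->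
  exists u w : R -> R,
  [/\ forall t, u (- t) = u t, forall t, w (- t) = - w t,
      solution lam 0 u w, 0 < u 0 &
      forall t : R, [/\ 0 <= u t, u t ^+ 2 <= energy_const * lam `^ r &
                        w t ^+ 2 <= energy_const * lam `^ r]].
Proof.
move=> l0 small; pose L := lam `^ r; have L0 : 0 < L by exact: powR_gt0.
pose eta_ n := Num.sqrt L / n.+1%:R : R.
have eta0 n : 0 < eta_ n by rewrite divr_gt0 // sqrtr_gt0.
have etaT n : eta_ n ^+ 2 * n.+1%:R <= L.
  rewrite /eta_ expr_div_n sqr_sqrtr ?(ltW L0) // expr2 invfM mulrA.
  by rewrite divfK // ler_piMr ?(ltW L0) // invf_le1 // ler1n.
have eta_cvg : eta_ n @[n --> \oo] --> 0.
  rewrite -[X in _ --> X](mulr0 (Num.sqrt L)).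
  by apply: cvgM; [exact: cvg_cst|exact: cvg_harmonic].
have ex n : exists uw : (R -> R) * (R -> R),
   [/\ forall t, uw.1 (- t) = uw.1 t, forall t, uw.2 (- t) = - uw.2 t,
       solution lam (eta_ n) uw.1 uw.2 & uw.1 n.+1%:R = 0].
  have [||||u [w [evu odw du dw uT]]] := @bvp_exists R A (source lam (eta_ n))
    gamma n.+1%:R gamma01 A_ge A_cont (@source_continuous lam (eta_ n)).
  - by move=> *; apply: source_ge0; rewrite ltW.
  - move=> S; have [B HB] := source_bounded S (ltW l0).
    by exists (B + eta_ n) => t x y tS; rewrite source_eta lerD2r HB.
  - exact: source_even.
  - by rewrite ltr0Sn.
  by exists (u, w).
have /choice[uw Huw] := ex.
pose u_ n := (uw n).1; pose w_ n := (uw n).2.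
have sol n : solution lam (eta_ n) (u_ n) (w_ n) by case: (Huw n).
have w_0 n : w_ n 0 = 0.
  by have [_ /(_ 0) + _ _] := Huw n; rewrite oppr0 -/(w_ n) => /eqP;
     rewrite -addr_eq0 -mulr2n mulrn_eq0 /= => /eqP.
have uT n : u_ n n.+1%:R = 0 by case: (Huw n).
have nonneg n (t : R) : 0 <= t <= n.+1%:R -> 0 <= u_ n t.
  exact: (solution_ge0 (ltW l0) (ltW (eta0 n)) _ (sol n) (w_0 n) (uT n)).
have bound n (t : R) : 0 <= t <= n.+1%:R ->
    u_ n t ^+ 2 <= energy_const * L /\ w_ n t ^+ 2 <= energy_const * L.
  exact: (bvp_bound (ltW l0) (ltW (eta0 n)) _ (sol n) (w_0 n) (uT n) (etaT n) small).
have le1 (x : R) : x ^+ 2 <= energy_const * L -> `|x| <= 1.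
  move=> H; rewrite -(@ler_sqr _ `|x|) ?nnegrE // expr1n real_normK ?num_real //.
  exact: le_trans small.
have [al al0 Hal] := initial_value_lb l0.
have near_T (T : R) : \forall n \near \oo, T <= n.+1%:R.
  near=> n; apply: (@le_trans _ _ n%:R); last by rewrite ler_nat.
  by near: n; exact: nbhs_infty_ger.
have cK : continuous (fun z : R * R * R => z.1.2 - source lam 0 z.1.1 z.1.2 z.2).
  move=> z; apply: cvgB; last exact: source_continuous.
  apply: (@continuous_comp _ _ _ (fun z : R * R * R => z.1));
  [exact: cvg_fst|exact: cvg_snd].
have cF : continuous (fun z : R * R * R => z.2 / A z.1.2).
  move=> z; apply: cvgM; first exact: cvg_snd.
  apply: cvgV; first by rewrite gt_eqF.
  apply: (@continuous_comp _ _ _ (fun z : R * R * R => z.1.2)); last exact: A_cont.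
  by apply: (@continuous_comp _ _ _ (fun z : R * R * R => z.1));
  [exact: cvg_fst|exact: cvg_snd].
have [||||G [u [w [PG oG uu ww Hder]]]] := @ode_compactness R
  (fun t x y => y / A x) (fun t x y => x - source lam 0 t x y) u_ w_ (fun=> 0)
  eta_ cF cK _ eta_cvg.
- exact: cvg_cst.
- by move=> n; apply: is_derive_approx_slope => t _; exact: (sol n).1.
- move=> n; apply: is_derive_approx_slope => t _.
  by have := (sol n).2 t; rewrite source_eta opprD addrA.
- move=> T; have [B HB] := source_bounded T (ltW l0).
  exists (gamma^-1 + 1 + `|B| + Num.sqrt L).
  have g0 : 0 <= gamma^-1 by rewrite invr_ge0 ltW.
  have B0 : 0 <= `|B| by [].
  have S0 := sqrtr_ge0 L.
  near=> n => t /andP[t0 tT].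
  have tn : 0 <= t <= n.+1%:R.
    by rewrite t0 (le_trans tT) //; near: n; exact: near_T.
  have [/le1 bu /le1 bw] := bound n t tn.
  split; [by apply: le_trans bu _; lra|by apply: le_trans bw _; lra| |].
  + apply: (@le_trans _ _ gamma^-1); last by lra.
    rewrite normrM normfV (gtr0_norm (A_gt0 _)) -[leRHS]mul1r.
    by rewrite ler_pM ?invr_ge0 ?(ltW (A_gt0 _)) // lef_pV2 ?posrE.
  + have en : eta_ n <= Num.sqrt L.
      by rewrite /eta_ ler_pdivrMr // ler_peMr // ler1n.
    have e0 := eta0 n.
    have s0 : 0 <= source lam 0 t (u_ n t) (w_ n t).
      exact: source_ge0 (ltW l0) (lexx 0).
    have sB : source lam 0 t (u_ n t) (w_ n t) <= `|B|.
      by rewrite (le_trans (HB _ _ _ _)) ?t0 ?ler_norm.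
    move: bu => /ler_normlP[u1 u2].
    by apply/ler_normlP; split; lra.
have w0 : w 0 = 0.
  apply: (cvg_unique _ (ww 0 (lexx 0)) _) => //.
  have -> : w_^~ 0 = fun=> 0 by apply/funext => n; exact: w_0.
  exact: cvg_cst.
have lim_prop (t : R) : 0 <= t -> [/\ 0 <= u t, u t ^+ 2 <= energy_const * L &
                        w t ^+ 2 <= energy_const * L].
  move=> t0; have nt : \forall n \near G, 0 <= t <= n.+1%:R.
    by apply: filterS (oG _ (near_T t)) => n ->; rewrite t0.
  split.
  - apply: (@ler_cvg_to _ G _ _ (fun=> 0) (fun n => u_ n t)); first exact: cvg_cst.
      exact: uu.
    by apply: filterS nt => n; exact: nonneg.
  - apply: (@ler_cvg_to _ G _ _ (fun n => u_ n t ^+ 2) (fun=> energy_const * L)).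
    + by rewrite expr2; under eq_fun do rewrite expr2; apply: cvgM; exact: uu.
    + exact: cvg_cst.
    + by apply: filterS nt => n /bound[].
  - apply: (@ler_cvg_to _ G _ _ (fun n => w_ n t ^+ 2) (fun=> energy_const * L)).
    + by rewrite expr2; under eq_fun do rewrite expr2; apply: cvgM; exact: ww.
    + exact: cvg_cst.
    + by apply: filterS nt => n /bound[].
have u00 : al <= u 0.
  apply: (@ler_cvg_to _ G _ _ (fun=> al) (fun n => u_ n 0)); first exact: cvg_cst.
    exact: uu.
  apply: nearW => n; apply: (Hal _ _ _ n.+1%:R (eta0 n) _ (sol n) (w_0 n) (uT n)).
  by rewrite ler1n.
have [||U [W [UW evU odW dU dW]]] := @reflect_solution R
  (fun t x y => y / A x) (fun t x y => x - source lam 0 t x y) u w _ _ w0 Hder.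
- by move=> t x y; rewrite mulNr.
- by move=> t x y; rewrite source_even.
exists U, W; split => //.
  by have [-> _] := UW 0 (lexx 0); exact: lt_le_trans u00.
have pos (t : R) : 0 <= t -> [/\ 0 <= U t, U t ^+ 2 <= energy_const * L &
                        W t ^+ 2 <= energy_const * L].
  by move=> t0; have [-> ->] := UW t t0; exact: lim_prop.
move=> t; have [/pos //|t0] := leP 0 t.
have /pos : 0 <= - t by rewrite oppr_ge0 ltW.
by rewrite evU odW sqrrN.
Unshelve. all: by end_near. Qed.

End Model.

(** * The quasilinear problem *)

(** The integrability of the weight is used through a bounded primitive, which
    turns integral estimates into monotonicity of energies. *)
Lemma integrable_primitive (R : realType) (f : R -> R) (r : R) :
  1 <= r -> f \in Lfun (@lebesgue_measure R) r%:E -> continuous f ->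
  (forall t, 0 < f t) ->
  exists Q : R -> R, exists2 M, 0 <= M &
    (forall t : R, is_derive t 1 Q (f t `^ r)) /\ (forall t, 0 <= Q t <= M).
Proof.
move=> r1 /(Lfun_integrable r1) intf cf f0; set mu := @lebesgue_measure R.
pose F t := f t `^ r.
have {}intf : mu.-integrable setT (EFin \o F).
  by have -> : EFin \o F = (fun x => (`|f x| `^ r)%:E);
     [apply/funext => x; rewrite /= /F gtr0_norm|].
have F0 x : 0 <= F x by exact: powR_ge0.
have intS (D : set R) : measurable D -> mu.-integrable D (EFin \o F).
  by move=> mD; apply: integrableS intf.
pose Q t := \int[mu]_(s in [set` Interval -oo%O (BRight t)]) F s.
pose M := \int[mu]_(s in setT) F s.
have cF : continuous F.
  move=> t; have -> : F = (fun x => Num.max x 0 `^ r) \o f.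
    by apply/funext => x /=; rewrite max_l // ltW.
  apply: continuous_comp; first exact: cf.
  by apply: powR_pos_continuous; exact: lt_le_trans r1.
exists Q, M; first by apply: Rintegral_ge0.
split=> t.
  have lt1 : t < t + 1 by rewrite ltrDl.
  have intt : mu.-integrable [set` Interval -oo%O (BRight (t + 1))] (EFin \o F).
    exact: intS.
  have [|d E] := @continuous_FTC1 R F -oo%O t (t + 1) lt1 intt _ (cF t).
    by rewrite ltNyr.
  by apply: DeriveDef; [exact: d|rewrite -derive1E; exact: E].
rewrite Rintegral_ge0 //= /Q /M /Rintegral fine_le //.
- by apply: integrable_fin_num => //; exact: intS.
- exact: integrable_fin_num.
- apply: ge0_subset_integral => //; last by move=> x _; rewrite lee_fin.
  by apply: measurable_int intf.
Qed.

Lemma derive1_eq (R : realType) (f f' : R -> R) :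
  (forall t : R, is_derive t 1 f (f' t)) -> f^`()%classic = f'.
Proof. by move=> H; apply/funext => t; have [_] := H t; rewrite derive1E. Qed.

Lemma solution_class_C2 (R : realType) (A u w v : R -> R) :
  class_C 1 A -> (forall x, 0 < A x) ->
  (forall t : R, is_derive t 1 u (w t / A (u t))) ->
  (forall t : R, is_derive t 1 w (v t)) -> continuous v -> class_C 2 u.
Proof.
move=> [dA cA'] A0 du dw cv.
have dA' (x : R) : is_derive x 1 A (A^`()%classic x).
  by apply: DeriveDef; [exact: (dA 0%N)|rewrite -derive1E].
have cA : continuous A by move=> x; exact: is_derive_continuous (dA' x).
have cu : continuous u by move=> x; exact: is_derive_continuous (du x).
have cw : continuous w by move=> x; exact: is_derive_continuous (dw x).
have cAu : continuous (A \o u).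
  by move=> x; apply: continuous_comp; [exact: cu|exact: cA].
pose u' t := w t / A (u t).
pose u'' t := v t / A (u t) +
  w t * (- (A (u t)) ^- 2 * (A^`()%classic (u t) * u' t)).
have du' (t : R) : is_derive t 1 u' (u'' t).
  have dAu := is_derive1_comp (dA' (u t)) (du t).
  have An0 : (A \o u) t != 0 by rewrite /= gt_eqF.
  exact: is_derive_mul (dw t) (is_deriveV An0 dAu).
have cAi : continuous (fun t => (A (u t))^-1).
  by move=> t; apply: cvgV; [rewrite gt_eqF|exact: cAu].
have e1 : u^`()%classic = u' := derive1_eq du.
have e2 : u'^`()%classic = u'' := derive1_eq du'.
split.
  case=> [|[|i]] i2 t; last by [].
    by have [] := du t.
  by rewrite derive1n1 e1; have [] := du' t.
rewrite derive1nS derive1n1 e1 e2 => t.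
apply: cvgD; first by apply: cvgM; [exact: cv|exact: cAi].
apply: cvgM; first exact: cw.
apply: cvgM.
  apply: cvgN; rewrite -exprVn expr2.
  have -> : (fun x => (A (u x)) ^- 2) = (fun x => (A (u x))^-1 * (A (u x))^-1).
    by apply/funext => x; rewrite -exprVn expr2.
  by apply: cvgM; exact: cAi.
apply: cvgM; last by apply: cvgM; [exact: cw|exact: cAi].
by apply: (@continuous_comp _ _ _ u); [exact: cu|exact: cA'].
Qed.

(** Continuity is what forces [g 0 = 0]. *)
Lemma slope_term_le (R : realType) (g : R -> R) (theta k eps : R) :
  continuous g -> (forall s : R, 0 <= s * g s <= `|s| `^ theta) -> 0 < eps ->
  2 < theta -> eps `^ (theta - 2) <= k ->
  forall s : R, 0 <= s <= eps -> 0 <= g s <= k * s.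
Proof.
move=> cg hg eps0 theta2 epsk.
have pos (s : R) : 0 < s -> s <= eps -> 0 <= g s <= k * s.
  move=> s0 seps; have := hg s; rewrite gtr0_norm // => /andP[h1 h2].
  rewrite -(pmulr_rge0 _ s0) h1 /= -(ler_pM2l s0); apply: le_trans h2 _.
  have -> : theta = (theta - 2) + 2%:R by ring.
  rewrite powRD; last by rewrite (gt_eqF s0) implybT.
  rewrite powR_mulrn ?(ltW s0) // expr2 [leRHS]mulrCA ler_wpM2r ?mulr_ge0 ?(ltW s0) //.
  apply: le_trans epsk; apply: ge0_ler_powR; rewrite ?nnegrE ?(ltW s0) ?(ltW eps0) //.
  by rewrite subr_ge0 ltW.
move=> s /andP[]; rewrite le_eqVlt => /predU1P[<- _|s0 ?]; last exact: pos.
have cg0 : g x @[x --> 0^'+] --> g 0 by exact: cvg_at_right_filter (cg 0).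
have near_eps : \forall x \near 0^'+, 0 <= g x <= k * x.
  near=> x; apply: pos; first by near: x; exact: nbhs_right_gt.
  by near: x; exact: nbhs_right_le.
apply/andP; split.
  apply: (@ler_cvg_to _ (0^'+) _ _ (fun=> 0) g) => //; first exact: cvg_cst.
  by apply: filterS near_eps => x /andP[].
apply: (@ler_cvg_to _ (0^'+) _ _ g (fun x => k * x)) => //.
  apply: cvg_at_right_filter; apply: cvgM; [exact: cvg_cst|exact: cvg_id].
by apply: filterS near_eps => x /andP[].
Unshelve. all: by end_near. Qed.

Theorem theorem1 (R : realType) (q p theta : R) (a1 A g : R -> R)
    (hq1 : 1 < q) (hq2 : q < 2) (hp : 2 < p)
    (htheta2 : 2 < theta) (htheta3 : theta <= 3)
    (ha1_Lp : a1 \in Lfun (@lebesgue_measure R) (2 / (2 - q))%:E)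
    (ha1_cont : continuous a1)
    (ha1_pos : forall t : R, 0 < a1 t)
    (ha1_even : even_function a1)
    (hA_lip : lipschitz A)
    (hA_C1 : class_C 1 A)
    (hA_mono : {homo A : x y / x <= y})
    (hA_gamma : exists2 gamma : R,
       0 < gamma < 1 & forall t : R, gamma <= A t)
    (hg_cont : continuous g)
    (hg : forall s : R, 0 <= s * g s <= `|s| `^ theta) :
  exists2 lambda_star : R, 0 < lambda_star &
    exists u : R -> R -> R,
      (forall lambda : R, 0 < lambda <= lambda_star ->
         [/\ class_C 2 (u lambda),
             even_function (u lambda) &
             solves_problem q p A a1 g lambda (u lambda)]) /\
      sup_norm (u lambda) @[lambda --> 0^'+] --> 0%E.
Proof.
have [gamma gamma01 hA_ge] := hA_gamma; have /andP[g0 g1] := gamma01.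
have A0 x : 0 < A x := lt_le_trans g0 (hA_ge x).
have q12 : 1 < q < 2 by rewrite hq1.
have q2 : 0 < 2 - q by rewrite subr_gt0.
have p20 : 0 < p - 2 by rewrite subr_gt0.
have th20 : 0 < theta - 2 by rewrite subr_gt0.
have cA : continuous A.
  move=> x; apply: differentiable_continuous; apply/derivable1_diffP.
  exact: (hA_C1.1 0%N).
pose r := 2 / (2 - q); have r0 : 0 < r by rewrite divr_gt0.
have r1 : 1 <= r by rewrite /r ler_pdivlMr //; lra.
have [Q [M M0 [dQ Qb]]] := integrable_primitive r1 ha1_Lp ha1_cont ha1_pos.
have [C C0 HC] := young_sublinear q12.
(* Below the level [eps] the terms [u `^ (p - 1)] and [g `|u'|] are at most
   [u / 8] and [gamma / 4 * `|u'|]. *)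
pose eps := Num.min 1 (Num.min ((1 / 8) `^ (p - 2)^-1) ((gamma / 4) `^ (theta - 2)^-1)).
have eps0 : 0 < eps by rewrite !lt_min ltr01 !powR_gt0 // divr_gt0.
have /and3P[eps1 epsp epsth] : [&& eps <= 1, eps <= (1 / 8) `^ (p - 2)^-1 &
    eps <= (gamma / 4) `^ (theta - 2)^-1] by rewrite -!le_min.
have eps01 : 0 < eps <= 1 by rewrite eps0.
have epsP : eps `^ (p - 2) <= 1 / 8.
  by apply: powR_le_small; rewrite ?divr_gt0 // ltW.
have epsG := slope_term_le hg_cont hg eps0 htheta2
  (powR_le_small th20 (divr_gt0 g0 (ltr0Sn _ 3)) (introT andP (conj (ltW eps0) epsth))).
pose D := energy_const gamma A C M.
have D0 : 0 < D.
  rewrite mulr_gt0 // ltr_wpDl //; last by rewrite !mulr_ge0.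
  by rewrite divr_ge0 ?(ltW g0) // mulr_ge0 // addr_ge0 ?sqr_ge0.
(* [u ^+ 2] and [w ^+ 2] will be at most [D * l `^ r]; below [bnd] they leave
   the truncations of [u] and of [u' = w / A u] inactive, as [A >= gamma]. *)
pose bnd := (gamma * eps) ^+ 2.
have ge0 : 0 < gamma * eps by rewrite mulr_gt0.
have gee : gamma * eps <= eps by rewrite ler_piMl ?(ltW eps0) ?(ltW g1).
pose ls := (bnd / D) `^ r^-1.
have bnd0 : 0 < bnd by rewrite exprn_gt0.
exists ls; first by rewrite powR_gt0 // divr_gt0.
suff H l : exists u : R -> R, 0 < l <= ls ->
    [/\ class_C 2 u, even_function u, solves_problem q p A a1 g l u &
        forall t, `|u t| <= Num.sqrt (D * l `^ r)].
  have /choice[u Hu] := H; exists u; split.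
    by move=> l /Hu[].
  apply: (@squeeze_cvge _ _ _ _ (fun=> 0%E) _ (fun l => (Num.sqrt (D * l `^ r))%:E)).
  - near=> l; have l0 : 0 < l by near: l; exact: nbhs_right_gt.
    have lls : l <= ls.
      by near: l; apply: nbhs_right_le; rewrite powR_gt0 // divr_gt0.
    have [|_ _ _ ub] := Hu l; first by rewrite l0.
    apply/andP; split.
      apply: (@le_trans _ _ (`|u l 0|%:E)); first by rewrite lee_fin.
      by apply: ereal_sup_ubound; exists 0.
    by apply: ub_ereal_sup => _ [t _ <-]; rewrite lee_fin.
  - exact: cvg_cst.
  - apply: cvg_EFin; first by apply: nearW.
    have powr0 : D * l `^ r @[l --> 0^'+] --> (0 : R).
      rewrite -[X in _ --> X](mulr0 D); apply: cvgM; first exact: cvg_cst.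
      exact: powR_cvg0.
    have sqrt0 := cvg_comp _ _ powr0 (@sqrt_continuous R 0).
    by rewrite sqrtr0 in sqrt0; exact: sqrt0.
have [/andP[l0 lls]|nl] := boolP (0 < l <= ls); last by exists (fun=> 0) => Hl; case/negP : nl.
have small : D * l `^ r <= bnd.
  rewrite mulrC -ler_pdivlMr //; apply: powR_le_small; rewrite ?divr_gt0 //.
  by rewrite ltW.
have small1 : D * l `^ r <= 1.
  by apply: le_trans small _; rewrite exprn_ile1 ?(ltW ge0) // (le_trans gee).
have [u [w [evu odw sol u0 bounds]]] := entire_solution q12 hp gamma01 hA_ge cA
  hA_mono ha1_cont ha1_pos ha1_even hg_cont eps01 epsP epsG C0 M0 HC dQ Qb l0 small1.
have u_gt0 t : 0 < u t.
  have pos := solution_gt0 q12 gamma01 hA_ge ha1_cont ha1_pos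
    eps01 epsG l0 sol (fun t => let: And3 h _ _ := bounds t in h) u0.
  by have [/pos //|t0] := leP 0 t; rewrite -evu pos // oppr_ge0 ltW.
have u_le t : u t <= gamma * eps.
  have [_ h _] := bounds t.
  rewrite -(@ler_sqr _ (u t)) ?nnegrE ?(ltW (u_gt0 t)) ?(ltW ge0) //.
  exact: le_trans small.
have w_le t : `|w t| <= gamma * eps.
  have [_ _ h] := bounds t.
  rewrite -(@ler_sqr _ `|w t|) ?nnegrE ?(ltW ge0) // real_normK ?num_real //.
  exact: le_trans small.
have [du dw] := sol.
have ueps t : u t <= eps := le_trans (u_le t) gee.
exists u => _; split.
- apply: (solution_class_C2 hA_C1 A0 du dw) => t.
  have cu : continuous u by move=> x; exact: is_derive_continuous (du x).
  have cw : continuous w by move=> x; exact: is_derive_continuous (dw x).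
  apply: cvgB; first exact: cu.
  have cs := source_continuous q12 hp gamma01 hA_ge cA ha1_cont hg_cont eps01.
  exact: (@continuous3_comp R R (source q p eps A a1 g l 0) id u w (cs l 0)
    (fun x => cvg_id) cu cw t).
- exact: evu.
- have du1 : u^`()%classic = fun t => w t / A (u t) := derive1_eq du.
  have decay := solution_decay q12 hp gamma01 hA_ge hA_mono ha1_pos eps01 epsP
    epsG C0 HC dQ Qb (ltW l0) sol.
  have {}decay e : 0 < e -> exists2 T, 0 <= T & forall t, T <= t -> u t < e.
    apply: decay => t _; rewrite (ltW (u_gt0 t)) (le_trans (ueps t)) //.
    by rewrite (le_trans (w_le t)) // (le_trans gee).
  split => //.
  + move=> t.
    have -> : (fun s : R => A (u s) * u^`()%classic s) = w.
      by apply/funext => s; rewrite du1 mulrC divfK // gt_eqF.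
    rewrite (derive1_eq dw) du1 opprB subrK /source addr0.
    rewrite clamp_id ?(ltW (u_gt0 t)) ?ueps // (gtr0_norm (u_gt0 t)).
    rewrite min_l; first by rewrite normrM normfV (gtr0_norm (A0 _)).
    rewrite ler_pdivrMr //; apply: le_trans (w_le t) _.
    by rewrite mulrC ler_pM2l.
  + apply/cvgrPdist_lt => e /decay[T T0 HT].
    exists (- T); split; first by rewrite realN num_real.
    move=> t tT; rewrite sub0r normrN gtr0_norm // -evu; apply: HT.
    by rewrite lerNr ltW.
  + apply/cvgrPdist_lt => e /decay[T T0 HT].
    exists T; split; first by rewrite num_real.
    by move=> t tT; rewrite sub0r normrN gtr0_norm // HT // ltW.
- move=> t; have [_ h _] := bounds t.
  by rewrite -sqrtr_sqr ler_wsqrtr.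
Unshelve. all: by end_near. Qed.
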